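(* For every integer $m\ge 1$, $$\sum_{n=1}^{\infty} \frac{\zeta(2n)}{n(2n+1)\cdots(2n+m)\,4^n} = \delta_{\lfloor \frac{m}{2} \rfloor, \frac{m}{2}}\frac{(-1)^{\frac{3m+2}{2}}(2^{m+1}-1)\,\zeta(m+1)}{(2\pi)^m}-\sum_{k=1}^{\lfloor \frac{m-1}{2} \rfloor} \frac{(-1)^k\,\zeta(2k+1)}{(m-2k)!\,\pi^{2k}}+\frac{\log\pi-H_{m}}{m!}.$$
   Context: The denominator on the left is $n\cdot\prod_{i=1}^{m}(2n+i)\cdot 4^n$. $\zeta$ is the Riemann zeta function. $H_m=\sum_{i=1}^m \frac1i$ is the $m$-th harmonic number. $\delta_{a,b}$ is the Kronecker delta, so $\delta_{\lfloor n/2\rfloor,n/2}$ is $1$ if $n$ is even and $0$ if $n$ is odd; a term multiplied by it is read as $0$ when $n$ is odd. Empty sums are $0$. *)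

(* Defs.v *)
From Stdlib Require Import Reals List Arith.
From Coquelicot Require Import Coquelicot.
Open Scope R_scope.

(* The Dirichlet series converges, and equals the Riemann zeta function, only
   for s > 1; at other arguments the value is meaningless. *)
Definition zeta (s : R) : R := Series (fun n => / Rpower (INR (S n)) s).

Definition harmonic (m : nat) : R := sum_n_m (fun i => / INR i) 1 m.

Definition kronecker (a b : R) : R := if Req_EM_T a b then 1 else 0.

Definition rising_prod (n m : nat) : R :=
  fold_right Rmult 1 (map (fun i => INR (2 * n + i)) (seq 1 m)).

(* Main.v *)
Require Import Defs.
From Stdlib Require Import Reals List Arith Lra Lia.
From Coquelicot Require Import Coquelicot.
Open Scope R_scope.

(** The series is an integral of a cotangent, and the cotangent is expanded in
    two ways.

    Write [c x = 1/x - PI/2 cot (PI x / 2)].  Expanded in powers of [x], it is the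
    sum over [n >= 1] of [2 zeta(2n) x^(2n-1) / 4^n]: this is the logarithmic
    derivative of Euler's product for the sine ([log_sine_product],
    [even_zeta_cotangent]).  The product itself comes from the integrals of
    [cos(2yt) cos^n t] over [0, PI/2], whose two-step recurrence produces the
    factors [1 - y^2/k^2], and whose ratio to the case [y = 0] tends to 1.
    Integrating the expansion against [(1-x)^m / m!] gives Beta integrals, and
    the left-hand side is the integral of [(1-x)^m c x / m!] over [0,1]
    ([moment_series]).

    Expanded in sines, [PI/2 cot (PI x / 2)] is formally the sum of
    [PI sin(k PI x)].  This is legitimate against the weight [1 - (1-x)^m], which
    vanishes at 0: the closed form of the finite sine sum leaves oscillating
    terms that tend to 0 by integration by parts ([riemann_lebesgue]).  What
    remains outside the sum are the integrals of [c], which is [ln (PI/2)], and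
    of [(1 - (1-x)^m) / x], which is the harmonic number ([sine_moment_series]).

    The integrals of [(1-x)^m sin(k PI x)] satisfy a two-step recurrence in [m],
    each step contributing a power [1/k^(2j+1)] ([fourier_term_closed]); summing
    over [k] gives the zeta values at odd arguments.  The recurrence ends at
    [m = 1], where nothing is left, or at [m = 2], where [1 - (-1)^k] keeps the
    odd [k] and gives the extra term for even [m].  The alternating harmonic
    series contributes the [ln 2] that completes [ln (PI/2)] to [ln PI]. *)

(** * Series and the zeta function at integers *)

(** Sums and scalar products are equal in the carrier of an algebraic structure,
    which [ring] does not recognize as [R]. *)
Ltac real_eq := match goal with |- @eq _ ?a ?b => change (@eq R a b) end.
Ltac real_ring := real_eq; ring.

Lemma sum_n_succ (a : nat -> R) (n : nat) :
  sum_n a (S n) = sum_n a n + a (S n).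
Proof. exact (sum_Sn a n). Qed.

Lemma sum_n_zero (a : nat -> R) : sum_n a 0 = a 0%nat.
Proof. exact (sum_O a). Qed.

Lemma is_series_lim (a : nat -> R) (l : R) :
  is_series a l <-> is_lim_seq (sum_n a) l.
Proof. split; intro H; exact H. Qed.

Lemma sum_n_le_series (a : nat -> R) (l : R) (N : nat) :
  (forall n, 0 <= a n) -> is_series a l -> sum_n a N <= l.
Proof.
  intros Ha Hl.
  apply (is_lim_seq_incr_compare (sum_n a) l Hl).
  intro n. rewrite sum_n_succ. specialize (Ha (S n)). lra.
Qed.

Lemma is_lim_seq_squeeze (u e : nat -> R) (l : R) :
  (forall n, Rabs (u n - l) <= e n) -> is_lim_seq e 0 -> is_lim_seq u l.
Proof.
  intros H He.
  apply is_lim_seq_le_le with (u := fun n => l - e n) (w := fun n => l + e n).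
  - intro n. specialize (H n). apply Rabs_le_between in H. lra.
  - replace (Finite l) with (Finite (l - 0)) by (f_equal; ring).
    apply is_lim_seq_minus'; [apply is_lim_seq_const | exact He].
  - replace (Finite l) with (Finite (l + 0)) by (f_equal; ring).
    apply is_lim_seq_plus'; [apply is_lim_seq_const | exact He].
Qed.

Lemma is_lim_seq_div_INR (c : R) : is_lim_seq (fun n => c / INR (S n)) 0.
Proof.
  replace (Finite 0) with (Finite (c * 0)) by (f_equal; ring).
  apply (is_lim_seq_scal_l _ c 0).
  apply (is_lim_seq_incr_1 (fun n => / INR n)).
  replace (Finite 0) with (Rbar_inv p_infty) by reflexivity.
  apply is_lim_seq_inv; [apply is_lim_seq_INR | discriminate].
Qed.

Lemma INR_S_pos (k : nat) : 0 < INR (S k).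
Proof. apply lt_0_INR. lia. Qed.

Lemma INR_S_ge_1 (k : nat) : 1 <= INR (S k).
Proof. rewrite S_INR. pose proof (pos_INR k). lra. Qed.

(** Comparison with twice the telescoping series of [1/k - 1/(k+1)]. *)
Lemma ex_series_inv_square : ex_series (fun k => / INR (S k) ^ 2).
Proof.
  apply (ex_series_le (V := R_CompleteNormedModule)) with (b := fun k => 2 * (/ INR (S k) - / INR (S (S k)))).
  - intro k. change (Rabs (/ INR (S k) ^ 2) <= 2 * (/ INR (S k) - / INR (S (S k)))).
    pose proof (INR_S_ge_1 k). rewrite (S_INR (S k)).
    set (x := INR (S k)) in *.
    rewrite Rabs_pos_eq by (left; apply Rinv_0_lt_compat; nra).
    replace (2 * (/ x - / (x + 1))) with (2 / (x * (x + 1))) by (field; lra).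
    apply Rmult_le_reg_r with (x ^ 2 * (x + 1)); [nra|].
    replace (/ x ^ 2 * (x ^ 2 * (x + 1))) with (x + 1) by (field; lra).
    replace (2 / (x * (x + 1)) * (x ^ 2 * (x + 1))) with (2 * x) by (field; lra).
    lra.
  - exists 2. apply is_series_lim.
    apply is_lim_seq_ext with (fun n => 2 - 2 / INR (S (S n))).
    + induction n.
      * rewrite sum_n_zero. simpl. field.
      * rewrite sum_n_succ, <- IHn. rewrite !(S_INR (S (S n))).
        pose proof (INR_S_pos (S n)). field. lra.
    + replace (Finite 2) with (Finite (2 - 0)) by (f_equal; ring).
      apply is_lim_seq_minus'; [apply is_lim_seq_const|].
      apply (is_lim_seq_incr_1 (fun n => 2 / INR (S n))), is_lim_seq_div_INR.
Qed.

Lemma inv_pow_pos (k s : nat) : 0 < / INR (S k) ^ s.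
Proof. apply Rinv_0_lt_compat, pow_lt, INR_S_pos. Qed.

Lemma inv_pow_le (k s t : nat) :
  (s <= t)%nat -> / INR (S k) ^ t <= / INR (S k) ^ s.
Proof.
  intro H. apply Rinv_le_contravar; [apply pow_lt, INR_S_pos|].
  apply Rle_pow; [apply INR_S_ge_1 | exact H].
Qed.

Lemma is_series_zeta (s : nat) :
  (2 <= s)%nat -> is_series (fun k => / INR (S k) ^ s) (zeta (INR s)).
Proof.
  intro Hs. unfold zeta.
  rewrite (Series_ext _ (fun k => / INR (S k) ^ s)).
  - apply Series_correct.
    apply (ex_series_le (V := R_CompleteNormedModule)) with (b := fun k => / INR (S k) ^ 2).
    + intro k. change (Rabs (/ INR (S k) ^ s) <= / INR (S k) ^ 2).
      rewrite Rabs_pos_eq by (left; apply inv_pow_pos).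
      apply inv_pow_le, Hs.
    + exact ex_series_inv_square.
  - intro k. rewrite Rpower_pow; [reflexivity | apply INR_S_pos].
Qed.

Lemma zeta_partial_le (s N : nat) :
  (2 <= s)%nat -> sum_n (fun k => / INR (S k) ^ s) N <= zeta (INR s).
Proof.
  intro Hs. apply sum_n_le_series; [|apply is_series_zeta, Hs].
  intro k. left. apply inv_pow_pos.
Qed.

(** Each term of the tail decreases with the exponent.  The bound is uniform in
    [s], which makes the exchange of summations below work. *)
Lemma zeta_tail_le (s N : nat) :
  (2 <= s)%nat ->
  zeta (INR s) - sum_n (fun k => / INR (S k) ^ s) N
  <= zeta (INR 2) - sum_n (fun k => / INR (S k) ^ 2) N.
Proof.
  intro Hs.
  assert (H : is_series (fun k => / INR (S k) ^ 2 - / INR (S k) ^ s)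
                (zeta (INR 2) - zeta (INR s))).
  { apply (is_series_minus (fun k => / INR (S k) ^ 2)
             (fun k => / INR (S k) ^ s)); apply is_series_zeta; lia. }
  apply sum_n_le_series with (N := N) in H.
  - assert (E : sum_n (fun k => / INR (S k) ^ 2 - / INR (S k) ^ s) N
      = sum_n (fun k => / INR (S k) ^ 2) N - sum_n (fun k => / INR (S k) ^ s) N).
    { clear. induction N.
      - rewrite !sum_n_zero. reflexivity.
      - rewrite !sum_n_succ, IHN. real_ring. }
    rewrite E in H. lra.
  - intro k. pose proof (inv_pow_le k 2 s Hs). lra.
Qed.

Lemma zeta_le_zeta2 (s : nat) : (2 <= s)%nat -> 0 <= zeta (INR s) <= zeta (INR 2).
Proof.
  intro Hs. split.
  - apply Rle_trans with (2 := zeta_partial_le s 0 Hs).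
    rewrite sum_n_zero. left. apply inv_pow_pos.
  - pose proof (zeta_tail_le s 0 Hs) as H. rewrite !sum_n_zero in H.
    replace (INR 1) with 1 in H by reflexivity.
    rewrite !pow1 in H. lra.
Qed.

(** * Euler's product for the sine *)

Lemma continuous_of_derive (f : R -> R) (x l : R) :
  is_derive f x l -> continuous f x.
Proof. intro H. apply (ex_derive_continuous f). exists l. exact H. Qed.

(** Continuity of an elementary function, through its differentiability. *)
Ltac by_derive :=
  apply (ex_derive_continuous (V := R_NormedModule)); auto_derive; auto.

Definition wallis (n : nat) (y : R) : R :=
  RInt (fun t => cos (2 * y * t) * cos t ^ n) 0 (PI / 2).

Lemma ex_RInt_wallis (n : nat) (y : R) :
  ex_RInt (fun t => cos (2 * y * t) * cos t ^ n) 0 (PI / 2).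
Proof. apply (ex_RInt_continuous (V := R_CompleteNormedModule)). intros t _. by_derive. Qed.

(** The integrands of the two sides differ by the derivative of
    [n cos(2yt) sin t cos^(n-1) t - 2y sin(2yt) cos^n t], where [n] stands for
    [S (S n)]; it vanishes at both end points. *)
Lemma wallis_rec (n : nat) (y : R) :
  (INR (S (S n)) ^ 2 - 4 * y ^ 2) * wallis (S (S n)) y
  = INR (S (S n)) * INR (S n) * wallis n y.
Proof.
  set (a := INR (S (S n))).
  assert (Ha : INR (S n) = a - 1) by (unfold a; rewrite (S_INR (S n)); ring).
  rewrite Ha.
  assert (H : is_RInt (fun t =>
       (a ^ 2 - 4 * y ^ 2) * (cos (2 * y * t) * cos t ^ S (S n))
       - a * (a - 1) * (cos (2 * y * t) * cos t ^ n)) 0 (PI / 2)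
     ((a ^ 2 - 4 * y ^ 2) * wallis (S (S n)) y - a * (a - 1) * wallis n y)).
  { apply (is_RInt_minus (V := R_NormedModule)
      (fun t => (a ^ 2 - 4 * y ^ 2) * (cos (2 * y * t) * cos t ^ S (S n)))
      (fun t => a * (a - 1) * (cos (2 * y * t) * cos t ^ n)));
    apply (is_RInt_scal (V := R_NormedModule));
    apply (RInt_correct (V := R_CompleteNormedModule)), ex_RInt_wallis. }
  pose (F := fun t => a * cos (2 * y * t) * sin t * cos t ^ S n
                      - 2 * y * sin (2 * y * t) * cos t ^ S (S n)).
  assert (H' : is_RInt (fun t =>
       (a ^ 2 - 4 * y ^ 2) * (cos (2 * y * t) * cos t ^ S (S n))
       - a * (a - 1) * (cos (2 * y * t) * cos t ^ n)) 0 (PI / 2)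
       (F (PI / 2) - F 0)).
  { apply (is_RInt_derive (V := R_CompleteNormedModule) F).
    - intros t _. unfold F. auto_derive; [exact I|].
      change (match n with 0%nat => 1 | S _ => INR n + 1 end) with (INR (S n)).
      rewrite Ha.
      replace (a * (a - 1) * (cos (2 * y * t) * cos t ^ n)) with
       (a * (a - 1) * (cos (2 * y * t) * cos t ^ n) * (sin t ^ 2 + cos t ^ 2))
       by (pose proof (sin2_cos2 t) as E; unfold Rsqr in E;
           replace (sin t ^ 2 + cos t ^ 2) with 1 by (rewrite <- E; ring); ring).
      simpl. ring.
    - intros t _. by_derive. }
  pose proof (is_RInt_unique _ _ _ _ H) as E1.
  pose proof (is_RInt_unique _ _ _ _ H') as E2.
  assert (EF : F (PI / 2) - F 0 = 0).
  { unfold F. rewrite cos_PI2, !Rmult_0_r, sin_0. simpl. ring. }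
  rewrite E1, EF in E2. lra.
Qed.

Lemma wallis_0 (y : R) : y <> 0 -> wallis 0 y = sin (PI * y) / (2 * y).
Proof.
  intro Hy. unfold wallis. apply is_RInt_unique.
  replace (sin (PI * y) / (2 * y)) with
    (sin (2 * y * (PI / 2)) / (2 * y) - sin (2 * y * 0) / (2 * y)).
  - apply (is_RInt_derive (V := R_CompleteNormedModule) (fun t => sin (2 * y * t) / (2 * y))).
    + intros t _. auto_derive; [exact I|]. simpl. field. exact Hy.
    + intros t _. by_derive.
  - rewrite Rmult_0_r, sin_0.
    replace (2 * y * (PI / 2)) with (PI * y) by field. field. exact Hy.
Qed.

Lemma wallis_0_0 : wallis 0 0 = PI / 2.
Proof.
  unfold wallis. rewrite (RInt_ext _ (fun _ => 1)).
  - rewrite RInt_const. change (scal ?a ?b) with (a * b). ring.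
  - intros t _. rewrite Rmult_0_r, Rmult_0_l, cos_0. simpl. ring.
Qed.

Lemma wallis_even_rec (N : nat) (y : R) :
  (1 - y ^ 2 / INR (S N) ^ 2) * wallis (2 * S N) y
  = (1 - / (2 * INR (S N))) * wallis (2 * N) y.
Proof.
  pose proof (wallis_rec (2 * N) y) as H.
  replace (2 * S N)%nat with (S (S (2 * N))) by lia.
  replace (INR (S (S (2 * N)))) with (2 * INR (S N)) in H
    by (rewrite !S_INR, mult_INR; simpl; ring).
  replace (INR (S (2 * N))) with (2 * INR (S N) - 1) in H
    by (rewrite !S_INR, mult_INR; simpl; ring).
  pose proof (INR_S_pos N).
  apply Rmult_eq_reg_l with (4 * INR (S N) ^ 2); [|nra].
  transitivity (((2 * INR (S N)) ^ 2 - 4 * y ^ 2) * wallis (S (S (2 * N))) y).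
  - field. lra.
  - rewrite H. field. lra.
Qed.

Lemma wallis_even_pos (N : nat) : 0 < wallis (2 * N) 0.
Proof.
  induction N.
  - rewrite Nat.mul_0_r, wallis_0_0. pose proof PI_RGT_0. lra.
  - pose proof (wallis_even_rec N 0) as H.
    replace (0 ^ 2 / INR (S N) ^ 2) with 0 in H
      by (field; pose proof (INR_S_pos N); lra).
    rewrite Rminus_0_r, Rmult_1_l in H. rewrite H.
    apply Rmult_lt_0_compat; [|exact IHN].
    pose proof (INR_S_ge_1 N).
    assert (/ (2 * INR (S N)) <= / 2) by (apply Rinv_le_contravar; lra). lra.
Qed.

Lemma continuity_pt_ex_derive (f : R -> R) (x : R) :
  ex_derive f x -> continuity_pt f x.
Proof.
  intro H. apply continuity_pt_filterlim, (ex_derive_continuous f), H.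
Qed.

Lemma mul_cos_le_sin (t : R) : 0 <= t <= PI / 2 -> t * cos t <= sin t.
Proof.
  intro Ht.
  destruct (MVT_gen (fun t => sin t - t * cos t) 0 t (fun t => t * sin t))
    as [c [Hc E]].
  - intros x _. auto_derive; [exact I | ring].
  - intros x _. apply continuity_pt_ex_derive. auto_derive. exact I.
  - rewrite Rmin_left, Rmax_right in Hc by lra.
    rewrite sin_0 in E.
    assert (0 <= sin c) by (apply sin_ge_0; pose proof PI_RGT_0; lra).
    assert (0 <= c * sin c * (t - 0)) by (apply Rmult_le_pos; [apply Rmult_le_pos|]; lra).
    lra.
Qed.

Lemma one_minus_cos_bounds (x : R) : 0 <= 1 - cos x <= x ^ 2 / 2.
Proof.
  replace x with (2 * (x / 2)) at 1 2 by field.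
  rewrite cos_2a_sin.
  replace (1 - (1 - 2 * sin (x / 2) * sin (x / 2))) with (2 * sin (x / 2) ^ 2) by ring.
  assert (H : sin (x / 2) ^ 2 <= (x / 2) ^ 2).
  { rewrite <- (pow2_abs (sin (x / 2))), <- (pow2_abs (x / 2)).
    apply pow_incr. split; [apply Rabs_pos|].
    assert (P : forall z, 0 <= z -> Rabs (sin z) <= z).
    { intros z Hz. destruct (MVT_gen sin 0 z cos) as [c [_ E]].
      - intros w _. auto_derive; [exact I | ring].
      - intros w _. apply continuity_pt_ex_derive. auto_derive. exact I.
      - rewrite sin_0, !Rminus_0_r in E. rewrite E, Rabs_mult, (Rabs_pos_eq z Hz).
        assert (Rabs (cos c) <= 1) by (apply Rabs_le; apply COS_bound).
        pose proof (Rabs_pos (cos c)). nra. }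
    destruct (Rle_or_lt 0 (x / 2)) as [Hx|Hx].
    - rewrite (Rabs_pos_eq _ Hx). apply P, Hx.
    - rewrite <- Rabs_Ropp, <- sin_neg, (Rabs_left _ Hx). apply P. lra. }
  pose proof (pow2_ge_0 (sin (x / 2))). lra.
Qed.

(** [1 - cos(2yt)] is at most [2 y^2 t^2], and one factor [cos^2 t] turns
    [t^2] into at most [sin^2 t = 1 - cos^2 t], so that the error is again a
    difference of Wallis integrals. *)
Lemma wallis_even_bounds (N : nat) (y : R) :
  0 <= wallis (2 * S N) 0 - wallis (2 * S N) y
    <= 2 * y ^ 2 * (wallis (2 * N) 0 - wallis (2 * S N) 0).
Proof.
  unfold wallis.
  set (n := (2 * N)%nat). replace (2 * S N)%nat with (S (S n)) by (unfold n; lia).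
  assert (HI : forall k z, is_RInt (fun t => cos (2 * z * t) * cos t ^ k) 0 (PI / 2)
              (wallis k z)).
  { intros k z. apply (RInt_correct (V := R_CompleteNormedModule)), ex_RInt_wallis. }
  fold (wallis (S (S n)) 0). fold (wallis (S (S n)) y). fold (wallis n 0).
  assert (HD := is_RInt_minus (V := R_NormedModule) _ _ _ _ _ _ (HI (S (S n)) 0) (HI (S (S n)) y)).
  assert (HB := is_RInt_scal (V := R_NormedModule) _ _ _ (2 * y ^ 2) _
     (is_RInt_minus (V := R_NormedModule) _ _ _ _ _ _ (HI n 0) (HI (S (S n)) 0))).
  assert (HP : 0 <= PI / 2) by (pose proof PI_RGT_0; lra).
  assert (E0 : forall t, cos (2 * 0 * t) = 1).
  { intro t. rewrite Rmult_0_r, Rmult_0_l. apply cos_0. }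
  assert (Hp : forall t, 0 <= cos t ^ n).
  { intro t. unfold n. rewrite pow_mult. apply pow_le, pow2_ge_0. }
  split.
  - refine (is_RInt_le _ _ _ _ 0 _ HP _ HD _).
    + replace 0 with (scal (PI / 2 - 0) 0) at 2 by (change (scal ?a ?b) with (a * b); real_ring).
      apply (is_RInt_const (V := R_NormedModule) 0 (PI / 2) 0).
    + intros t _. rewrite E0.
      change (0 <= 1 * cos t ^ S (S n) - cos (2 * y * t) * cos t ^ S (S n)).
      pose proof (one_minus_cos_bounds (2 * y * t)).
      replace (1 * cos t ^ S (S n) - cos (2 * y * t) * cos t ^ S (S n)) with
        ((1 - cos (2 * y * t)) * (cos t ^ 2 * cos t ^ n)) by (simpl; ring).
      apply Rmult_le_pos; [lra|]. apply Rmult_le_pos; [apply pow2_ge_0|apply Hp].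
  - refine (is_RInt_le _ _ _ _ _ _ HP HD HB _).
    intros t Ht. rewrite !E0.
    change (1 * cos t ^ S (S n) - cos (2 * y * t) * cos t ^ S (S n)
      <= 2 * y ^ 2 * (1 * cos t ^ n - 1 * cos t ^ S (S n))).
    pose proof (one_minus_cos_bounds (2 * y * t)).
    replace (1 * cos t ^ S (S n) - cos (2 * y * t) * cos t ^ S (S n)) with
        ((1 - cos (2 * y * t)) * cos t ^ 2 * cos t ^ n) by (simpl; ring).
    replace (2 * y ^ 2 * (1 * cos t ^ n - 1 * cos t ^ S (S n))) with
        (2 * y ^ 2 * sin t ^ 2 * cos t ^ n)
      by (pose proof (sin2_cos2 t) as E; unfold Rsqr in E;
          replace (sin t ^ 2) with (1 - cos t ^ 2) by (simpl; lra); simpl; ring).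
    apply Rmult_le_compat_r; [apply Hp|].
    apply Rle_trans with ((2 * y * t) ^ 2 / 2 * cos t ^ 2).
    + apply Rmult_le_compat_r; [apply pow2_ge_0|lra].
    + replace ((2 * y * t) ^ 2 / 2 * cos t ^ 2) with (2 * y ^ 2 * (t * cos t) ^ 2) by field.
      apply Rmult_le_compat_l; [pose proof (pow2_ge_0 y); lra|].
      apply pow_incr. split; [|apply mul_cos_le_sin; lra].
      apply Rmult_le_pos; [lra|]. apply cos_ge_0; lra.
Qed.

Definition wallis_ratio (N : nat) (y : R) : R := wallis (2 * N) y / wallis (2 * N) 0.

(** By the recurrence at frequency 0, the upper bound of [wallis_even_bounds] is
    [2 y^2 / (2N + 1)] times the integral itself. *)
Lemma wallis_ratio_lim (y : R) : is_lim_seq (fun N => wallis_ratio N y) 1.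
Proof.
  apply is_lim_seq_incr_1.
  apply is_lim_seq_squeeze with (fun N => 2 * y ^ 2 / INR (S N)).
  2: apply is_lim_seq_div_INR.
  intro N. unfold wallis_ratio.
  destruct (wallis_even_bounds N y) as [H1 H2].
  pose proof (wallis_even_rec N 0) as H3.
  pose proof (wallis_even_pos (S N)) as HP. pose proof (wallis_even_pos N) as HQ.
  pose proof (INR_S_ge_1 N) as HN.
  set (n := INR (S N)) in *. set (A := wallis (2 * S N) 0) in *.
  set (B := wallis (2 * N) 0) in *. set (C := wallis (2 * S N) y) in *.
  replace (C / A - 1) with (- ((A - C) / A)) by (field; lra).
  rewrite Rabs_Ropp, Rabs_pos_eq.
  2: { apply Rmult_le_pos; [lra | left; apply Rinv_0_lt_compat, HP]. }
  apply Rmult_le_reg_r with A; [exact HP|].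
  unfold Rdiv at 1. rewrite Rmult_assoc, Rinv_l, Rmult_1_r by lra.
  apply Rle_trans with (1 := H2).
  replace (2 * y ^ 2 / n * A) with (2 * y ^ 2 * (A / n)) by (field; lra).
  apply Rmult_le_compat_l; [pose proof (pow2_ge_0 y); lra|].
  assert (E : (2 * n - 1) * B = 2 * n * A).
  { replace (0 ^ 2 / n ^ 2) with 0 in H3 by (field; lra).
    apply Rmult_eq_reg_r with (/ (2 * n)); [|apply Rinv_neq_0_compat; lra].
    transitivity ((1 - / (2 * n)) * B); [field; lra|].
    rewrite <- H3. field. lra. }
  replace B with (2 * n * A / (2 * n - 1)) by (rewrite <- E; field; lra).
  replace (2 * n * A / (2 * n - 1) - A) with (A * / (2 * n - 1)) by (field; lra).
  apply Rmult_le_compat_l; [lra|]. apply Rinv_le_contravar; lra.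
Qed.

(** The recurrence says that the ratio at [N] is [1 - y^2/(N+1)^2] times the
    ratio at [N + 1].  It starts at [sin (PI y) / (PI y)] and tends to 1, so the
    product telescopes. *)
Lemma log_sine_product (y : R) :
  0 < y < 1 ->
  is_series (fun k => - ln (1 - y ^ 2 / INR (S k) ^ 2))
    (ln (PI * y) - ln (sin (PI * y))).
Proof.
  intro Hy. apply is_series_lim.
  pose proof PI_RGT_0 as HPI.
  assert (Hs : 0 < sin (PI * y)) by (apply sin_gt_0; nra).
  assert (HF : forall k, 0 < 1 - y ^ 2 / INR (S k) ^ 2).
  { intro k. pose proof (INR_S_ge_1 k).
    assert (y ^ 2 / INR (S k) ^ 2 < 1); [|lra].
    apply Rmult_lt_reg_r with (INR (S k) ^ 2); [nra|].
    unfold Rdiv. rewrite Rmult_assoc, Rinv_l; nra. }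
  assert (HR : forall N, wallis_ratio N y
                 = (1 - y ^ 2 / INR (S N) ^ 2) * wallis_ratio (S N) y).
  { intro N. unfold wallis_ratio.
    pose proof (wallis_even_rec N y) as H1.
    pose proof (wallis_even_rec N 0) as H0.
    pose proof (wallis_even_pos N) as HP. pose proof (wallis_even_pos (S N)) as HP'.
    pose proof (INR_S_ge_1 N) as HN.
    replace (0 ^ 2 / INR (S N) ^ 2) with 0 in H0 by (field; lra).
    rewrite Rminus_0_r, Rmult_1_l in H0.
    unfold Rdiv at 3. rewrite <- Rmult_assoc, H1.
    assert (0 < 1 - / (2 * INR (S N))).
    { assert (/ (2 * INR (S N)) <= / 2) by (apply Rinv_le_contravar; lra). lra. }
    rewrite H0. field. repeat split; try lra.  }
  assert (H0 : wallis_ratio 0 y = sin (PI * y) / (PI * y)).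
  { unfold wallis_ratio. rewrite Nat.mul_0_r, wallis_0_0, wallis_0 by lra. field. lra. }
  assert (HP : forall N, 0 < wallis_ratio N y).
  { induction N.
    - rewrite H0. apply Rdiv_lt_0_compat; nra.
    - apply Rmult_lt_reg_l with (1 := HF N). rewrite Rmult_0_r, <- HR. exact IHN. }
  assert (HS : forall N, sum_n (fun k => - ln (1 - y ^ 2 / INR (S k) ^ 2)) N
     = ln (wallis_ratio (S N) y) - ln (wallis_ratio 0 y)).
  { induction N.
    - rewrite sum_n_zero, (HR 0%nat), ln_mult by auto. real_ring.
    - rewrite sum_n_succ, IHN, (HR (S N)), ln_mult by auto. real_ring. }
  apply is_lim_seq_ext with (fun N => ln (wallis_ratio (S N) y) - ln (wallis_ratio 0 y)).
  { intro N. symmetry. apply HS. }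
  replace (ln (PI * y) - ln (sin (PI * y))) with (ln 1 - ln (wallis_ratio 0 y)).
  - apply is_lim_seq_minus'; [|apply is_lim_seq_const].
    apply (is_lim_seq_incr_1 (fun N => ln (wallis_ratio N y))).
    apply is_lim_seq_continuous; [|apply wallis_ratio_lim].
    apply continuity_pt_ex_derive. auto_derive. lra.
  - rewrite H0, ln_div, ln_1 by nra. ring.
Qed.

Lemma sum_n_plus_R (a b : nat -> R) (N : nat) :
  sum_n (fun k => a k + b k) N = sum_n a N + sum_n b N.
Proof. exact (sum_n_plus a b N). Qed.

Lemma sum_n_scal_R (c : R) (a : nat -> R) (N : nat) :
  sum_n (fun k => c * a k) N = c * sum_n a N.
Proof. exact (sum_n_mult_l (K := R_Ring) c a N). Qed.

Lemma is_series_le (a b : nat -> R) (la lb : R) :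
  (forall n, a n <= b n) -> is_series a la -> is_series b lb -> la <= lb.
Proof.
  intros H Ha Hb.
  apply (is_lim_seq_le (sum_n a) (sum_n b) la lb); [|exact Ha | exact Hb].
  intro N. apply sum_n_m_le, H.
Qed.

Lemma is_series_sum_n (a : nat -> nat -> R) (l : nat -> R) (N : nat) :
  (forall k, is_series (a k) (l k)) ->
  is_series (fun n => sum_n (fun k => a k n) N) (sum_n l N).
Proof.
  intro H. induction N.
  - rewrite sum_n_zero. apply is_series_ext with (2 := H 0%nat).
    intro n. rewrite sum_n_zero. reflexivity.
  - rewrite sum_n_succ.
    apply is_series_ext with (fun n => sum_n (fun k => a k n) N + a (S N) n).
    + intro n. rewrite sum_n_succ. reflexivity.
    + exact (is_series_plus (V := R_NormedModule) _ _ _ _ IHN (H (S N))).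
Qed.

(** * The power series of the logarithm *)

Definition log_partial (N : nat) (t : R) : R :=
  sum_n (fun k => t ^ S k / INR (S k)) N.

Lemma is_derive_log_remainder (N : nat) (t : R) :
  t < 1 ->
  is_derive (fun t => - ln (1 - t) - log_partial N t) t (t ^ S N / (1 - t)).
Proof.
  intro Ht. unfold log_partial. induction N.
  - apply is_derive_ext with (fun t => - ln (1 - t) - t).
    + intro s. rewrite sum_n_zero. simpl. field.
    + auto_derive; [lra|]. field. lra.
  - apply is_derive_ext with
      (fun t => (- ln (1 - t) - sum_n (fun k => t ^ S k / INR (S k)) N)
                - t ^ S (S N) / INR (S (S N))).
    + intro s. rewrite (sum_n_succ _ N). real_ring.
    + replace (t ^ S (S N) / (1 - t)) with (t ^ S N / (1 - t) - t ^ S N)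
        by (simpl; field; lra).
      apply (is_derive_minus (V := R_NormedModule)); [exact IHN|].
      auto_derive; [exact I|].
      change (match N with 0%nat => 1 | S _ => INR N + 1 end) with (INR (S N)).
      change (INR (S N) + 1) with (INR (S (S N))).
      pose proof (INR_S_pos (S N)). simpl pow. field. lra.
Qed.

Lemma log_remainder_zero (N : nat) : - ln (1 - 0) - log_partial N 0 = 0.
Proof.
  rewrite Rminus_0_r, ln_1. unfold log_partial.
  replace (sum_n (fun k => 0 ^ S k / INR (S k)) N) with 0; [ring|].
  induction N.
  - rewrite sum_n_zero. simpl. field.
  - rewrite sum_n_succ, <- IHN. simpl pow. unfold Rdiv. real_ring.
Qed.

Lemma mean_value (f df : R -> R) (a b : R) :
  a <= b -> (forall x, a <= x <= b -> is_derive f x (df x)) ->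
  exists c, a <= c <= b /\ f b - f a = df c * (b - a).
Proof.
  intros Hab H. destruct (MVT_gen f a b df) as [c Hc];
    rewrite ?Rmin_left, ?Rmax_right in * by lra.
  - intros x Hx. apply H. lra.
  - intros x Hx. apply continuity_pt_ex_derive. exists (df x). apply H, Hx.
  - exists c. exact Hc.
Qed.

Lemma log_series (t : R) :
  0 <= t < 1 -> is_series (fun k => t ^ S k / INR (S k)) (- ln (1 - t)).
Proof.
  intro Ht. apply is_series_lim.
  apply is_lim_seq_squeeze with (fun N => t * / (1 - t) * t ^ S N).
  - intro N. fold (log_partial N t).
    destruct (mean_value (fun t => - ln (1 - t) - log_partial N t)
               (fun t => t ^ S N / (1 - t)) 0 t) as [c [Hc E]]; [lra| |].
    { intros x Hx. apply is_derive_log_remainder. lra. }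
    rewrite log_remainder_zero, !Rminus_0_r in E.
    rewrite <- Rabs_Ropp.
    replace (- (log_partial N t - - ln (1 - t))) with
      (- ln (1 - t) - log_partial N t) by ring.
    rewrite E.
    assert (0 <= c ^ S N <= t ^ S N).
    { split; [apply pow_le; lra | apply pow_incr; lra]. }
    assert (0 < / (1 - c) <= / (1 - t)).
    { split; [apply Rinv_0_lt_compat | apply Rinv_le_contravar]; lra. }
    unfold Rdiv. rewrite Rabs_pos_eq.
    + replace (t * / (1 - t) * t ^ S N) with (t ^ S N * / (1 - t) * t) by ring.
      apply Rmult_le_compat_r; [lra|]. apply Rmult_le_compat; lra.
    + apply Rmult_le_pos; [apply Rmult_le_pos|]; lra.
  - replace (Finite 0) with (Finite (t * / (1 - t) * 0)) by (f_equal; ring).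
    apply (is_lim_seq_scal_l _ (t * / (1 - t)) 0).
    apply (is_lim_seq_incr_1 (fun N => t ^ N)), is_lim_seq_geom.
    rewrite Rabs_pos_eq; lra.
Qed.

Lemma is_RInt_pow_unit (n : nat) : is_RInt (fun x => x ^ n) 0 1 (/ INR (S n)).
Proof.
  replace (/ INR (S n)) with (1 ^ S n / INR (S n) - 0 ^ S n / INR (S n)).
  - apply is_RInt_pow.
  - rewrite pow1. pose proof (INR_S_pos n). simpl pow. field. lra.
Qed.

(** The end point [t = -1] of the logarithmic series: up to sign, the remainder is the
    integral of [(-r)^(N+1) / (1+r)], bounded by that of [r^(N+1)]. *)
Lemma alternating_harmonic_series :
  is_series (fun k => - (-1) ^ S k / INR (S k)) (ln 2).
Proof.
  apply is_series_lim.
  apply is_lim_seq_squeeze with (fun N => 1 / INR (S (S N))).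
  - intro N.
    assert (HI : is_RInt (fun r => - ((- r) ^ S N / (1 - - r))) 0 1
              (- ln (1 - -1) - log_partial N (-1))).
    { replace (- ln (1 - -1) - log_partial N (-1)) with
        ((- ln (1 - - 1) - log_partial N (- 1)) -
         (- ln (1 - - 0) - log_partial N (- 0)))
        by (rewrite Ropp_0, log_remainder_zero; ring).
      apply (is_RInt_derive (V := R_CompleteNormedModule)
               (fun r => - ln (1 - - r) - log_partial N (- r))).
      - intros r Hr. rewrite Rmin_left, Rmax_right in Hr by lra.
        replace (- ((- r) ^ S N / (1 - - r))) with
          (scal (-1) ((- r) ^ S N / (1 - - r)))
          by (change (scal ?a ?b) with (a * b); real_ring).
        apply (is_derive_comp (V := R_NormedModule)
          (fun t => - ln (1 - t) - log_partial N t) (fun r => - r)).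
        + apply is_derive_log_remainder. lra.
        + auto_derive; [exact I | ring].
      - intros r Hr. rewrite Rmin_left, Rmax_right in Hr by lra.
        by_derive. lra. }
    assert (HB : norm (- ln (1 - -1) - log_partial N (-1)) <= / INR (S (S N))).
    { apply (norm_RInt_le (V := R_NormedModule)) with (3 := HI) (4 := is_RInt_pow_unit (S N)).
      - lra.
      - intros r Hr. change (Rabs (- ((- r) ^ S N / (1 - - r))) <= r ^ S N).
        rewrite Rabs_Ropp. unfold Rdiv.
        rewrite Rabs_mult, <- RPow_abs, Rabs_Ropp, (Rabs_pos_eq r) by lra.
        rewrite Rabs_pos_eq by (left; apply Rinv_0_lt_compat; lra).
        rewrite <- (Rmult_1_r (r ^ S N)) at 2.
        apply Rmult_le_compat_l; [apply pow_le; lra|].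
        rewrite <- Rinv_1 at 2. apply Rinv_le_contravar; lra. }
    change (norm ?x) with (Rabs x) in HB.
    replace (sum_n (fun k => - (-1) ^ S k / INR (S k)) N) with (- log_partial N (-1)).
    + replace (1 - -1) with 2 in HB by ring.
      replace (- log_partial N (-1) - ln 2) with (- ln 2 - log_partial N (-1)) by ring.
      unfold Rdiv. rewrite Rmult_1_l. exact HB.
    + unfold log_partial.
      rewrite (sum_n_ext (fun k => - (-1) ^ S k / INR (S k))
         (fun k => (-1) * ((-1) ^ S k / INR (S k)))), sum_n_scal_R; [ring|].
      intro k. real_eq. unfold Rdiv. ring.
  - apply (is_lim_seq_incr_1 (fun n => 1 / INR (S n))), is_lim_seq_div_INR.
Qed.

(** * The generating function of the even zeta values *)

Definition even_zeta_series (u : R) : R := PSeries (fun n => zeta (INR (2 * S n))) u.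

(** Coefficients of the antiderivative of [even_zeta_series] that vanishes at 0. *)
Definition log_coef (n : nat) : R :=
  match n with 0%nat => 0 | S j => zeta (INR (2 * S j)) / INR (S j) end.

Lemma even_zeta_bound (n : nat) :
  0 <= zeta (INR (2 * S n)) <= zeta (INR 2).
Proof. apply zeta_le_zeta2. lia. Qed.

(** Expanding each logarithm gives a double series of nonnegative terms, which is
    summed in the other order: the partial sum over [k <= N] differs from the
    full series by at most the tail of [zeta 2] times [- ln (1 - u)]. *)
Lemma log_product_rearranged (u l : R) :
  0 <= u < 1 ->
  is_series (fun k => - ln (1 - u / INR (S k) ^ 2)) l ->
  is_series (fun n => zeta (INR (2 * S n)) * (u ^ S n / INR (S n))) l.
Proof.
  intros Hu Hl.
  assert (Hc : forall n, 0 <= u ^ S n / INR (S n)).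
  { intro n. apply Rmult_le_pos; [apply pow_le; lra|].
    left. apply Rinv_0_lt_compat, INR_S_pos. }
  pose proof (log_series u Hu) as HC. set (C := - ln (1 - u)) in HC.
  assert (Hex : ex_series (fun n => zeta (INR (2 * S n)) * (u ^ S n / INR (S n)))).
  { apply (ex_series_le (V := R_CompleteNormedModule)) with
      (b := fun n => zeta (INR 2) * (u ^ S n / INR (S n))).
    - intro n. change (norm ?x) with (Rabs x).
      pose proof (even_zeta_bound n). specialize (Hc n).
      rewrite Rabs_pos_eq by (apply Rmult_le_pos; lra).
      apply Rmult_le_compat_r; lra.
    - eexists. exact (is_series_scal (V := R_NormedModule) (zeta (INR 2)) _ _ HC). }
  destruct Hex as [L HL].
  enough (E : L = l) by (rewrite <- E; exact HL).
  assert (HN : forall N,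
    is_series (fun n => sum_n (fun k => / INR (S k) ^ (2 * S n)) N * (u ^ S n / INR (S n)))
      (sum_n (fun k => - ln (1 - u / INR (S k) ^ 2)) N)).
  { intro N.
    apply is_series_ext with
      (fun n => sum_n (fun k => (u / INR (S k) ^ 2) ^ S n / INR (S n)) N).
    - intro n. real_eq. rewrite Rmult_comm, <- sum_n_scal_R. apply sum_n_ext.
      intro k. real_eq. unfold Rdiv.
      rewrite Rpow_mult_distr, pow_inv, pow_mult. ring.
    - apply (is_series_sum_n (fun k n => (u / INR (S k) ^ 2) ^ S n / INR (S n))).
      intro k. apply log_series. pose proof (INR_S_ge_1 k).
      assert (0 < / INR (S k) ^ 2 <= 1).
      { split; [apply inv_pow_pos|]. rewrite <- Rinv_1.
        apply Rinv_le_contravar; nra. }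
      unfold Rdiv. nra. }
  assert (HA : is_lim_seq (sum_n (fun k => - ln (1 - u / INR (S k) ^ 2))) L).
  { apply is_lim_seq_squeeze with
      (fun N => (zeta (INR 2) - sum_n (fun k => / INR (S k) ^ 2) N) * C).
    - intro N.
      set (S2 := sum_n (fun k => / INR (S k) ^ 2) N).
      set (A := sum_n (fun k => - ln (1 - u / INR (S k) ^ 2)) N).
      assert (HD : is_series (fun n =>
          (zeta (INR 2) - S2) * (u ^ S n / INR (S n))
          + sum_n (fun k => / INR (S k) ^ (2 * S n)) N * (u ^ S n / INR (S n)))
          ((zeta (INR 2) - S2) * C + A)).
      { refine (is_series_plus (V := R_NormedModule) _ _ _ _ _ (HN N)).
        exact (is_series_scal (V := R_NormedModule) (zeta (INR 2) - S2) _ _ HC). }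
      assert (A <= L).
      { apply is_series_le with (2 := HN N) (3 := HL). intro n.
        apply Rmult_le_compat_r; [apply Hc|]. apply zeta_partial_le. lia. }
      assert (L <= (zeta (INR 2) - S2) * C + A).
      { apply is_series_le with (2 := HL) (3 := HD). intro n.
        rewrite <- Rmult_plus_distr_r. apply Rmult_le_compat_r; [apply Hc|].
        pose proof (zeta_tail_le (2 * S n) N ltac:(lia)) as T. fold S2 in T. lra. }
      apply Rabs_le. lra.
    - replace (Finite 0) with (Finite ((zeta (INR 2) - zeta (INR 2)) * C)) by (f_equal; ring).
      apply (is_lim_seq_scal_r _ C (zeta (INR 2) - zeta (INR 2))).
      apply is_lim_seq_minus'; [apply is_lim_seq_const|].
      apply is_series_lim, is_series_zeta. lia. }
  apply is_lim_seq_unique in HA. apply is_series_lim, is_lim_seq_unique in Hl.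
  rewrite HA in Hl. now injection Hl.
Qed.

Lemma even_zeta_radius (u : R) :
  Rabs u < 1 -> Rbar_lt (Rabs u) (CV_radius (fun n => zeta (INR (2 * S n)))).
Proof.
  intro Hu. apply Rbar_lt_le_trans with 1; [exact Hu|].
  apply (proj1 (CV_radius_bounded _)).
  exists (zeta (INR 2)). intro n. rewrite pow1, Rmult_1_r.
  rewrite Rabs_pos_eq; apply even_zeta_bound.
Qed.

Lemma is_derive_log_series (u : R) :
  Rabs u < 1 -> is_derive (PSeries log_coef) u (even_zeta_series u).
Proof.
  intro Hu.
  assert (E : forall n, PS_derive log_coef n = zeta (INR (2 * S n))).
  { intro n. unfold PS_derive, log_coef. pose proof (INR_S_pos n). field. lra. }
  unfold even_zeta_series. rewrite <- (PSeries_ext _ _ u E).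
  apply is_derive_PSeries. rewrite <- CV_radius_derive, (CV_radius_ext _ _ E).
  apply even_zeta_radius, Hu.
Qed.

Lemma log_series_sine (y : R) :
  0 < y < 1 -> PSeries log_coef (y ^ 2) = ln (PI * y) - ln (sin (PI * y)).
Proof.
  intro Hy. unfold PSeries. apply is_series_unique, is_series_decr_1.
  unfold log_coef at 2. rewrite Rmult_0_l.
  change (plus ?a (opp 0)) with (a + - 0). rewrite Ropp_0, Rplus_0_r.
  apply is_series_ext with
    (fun n => zeta (INR (2 * S n)) * ((y ^ 2) ^ S n / INR (S n))).
  - intro n. unfold log_coef, Rdiv. real_ring.
  - apply log_product_rearranged; [nra|]. apply log_sine_product, Hy.
Qed.

(** The logarithmic derivative of Euler's product: [log_series_sine] is an
    identity between functions of [y], and is differentiated.  Multiplying by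
    [y sin (PI y)] removes the pole at 0. *)
Lemma even_zeta_cotangent (y : R) :
  0 <= y < 1 ->
  sin (PI * y) * (1 - 2 * y ^ 2 * even_zeta_series (y ^ 2))
  = PI * y * cos (PI * y).
Proof.
  intros [[Hy|<-] Hy1].
  2: { rewrite Rmult_0_r, sin_0. ring. }
  pose proof PI_RGT_0 as HPI.
  assert (Hs : 0 < sin (PI * y)) by (apply sin_gt_0; nra).
  assert (D1 : is_derive (fun y => PSeries log_coef (y ^ 2)) y
                (scal (2 * y) (even_zeta_series (y ^ 2)))).
  { apply (is_derive_comp (V := R_NormedModule) (PSeries log_coef) (fun y => y ^ 2)).
    - apply is_derive_log_series. rewrite Rabs_pos_eq; nra.
    - auto_derive; [exact I | ring]. }
  assert (D2 : is_derive (fun y => ln (PI * y) - ln (sin (PI * y))) y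
                (/ y - PI * cos (PI * y) / sin (PI * y))).
  { auto_derive; [repeat split; nra|]. field. repeat split; lra. }
  apply is_derive_ext_loc with (g := fun y => ln (PI * y) - ln (sin (PI * y))) in D1.
  - pose proof (eq_trans (eq_sym (is_derive_unique _ _ _ D1))
                         (is_derive_unique _ _ _ D2)) as E.
    change (scal ?a ?b) with (a * b) in E.
    replace (2 * y ^ 2 * even_zeta_series (y ^ 2)) with
      (y * (2 * y * even_zeta_series (y ^ 2))) by ring.
    rewrite E. field. lra.
  - apply locally_interval with (Finite 0) (Finite 1); [exact Hy | exact Hy1|].
    intros z H0 H1. apply log_series_sine. split; [exact H0 | exact H1].
Qed.

(** * Integration term by term *)

Lemma is_RInt_plus_R (f g : R -> R) (a b lf lg : R) :
  is_RInt f a b lf -> is_RInt g a b lg ->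
  is_RInt (fun x => f x + g x) a b (lf + lg).
Proof. exact (is_RInt_plus (V := R_NormedModule) f g a b lf lg). Qed.

Lemma is_RInt_minus_R (f g : R -> R) (a b lf lg : R) :
  is_RInt f a b lf -> is_RInt g a b lg ->
  is_RInt (fun x => f x - g x) a b (lf - lg).
Proof. exact (is_RInt_minus (V := R_NormedModule) f g a b lf lg). Qed.

Lemma is_RInt_scal_R (c : R) (f : R -> R) (a b lf : R) :
  is_RInt f a b lf -> is_RInt (fun x => c * f x) a b (c * lf).
Proof. exact (is_RInt_scal (V := R_NormedModule) f a b c lf). Qed.

Lemma is_RInt_const_R (c a b : R) : is_RInt (fun _ => c) a b ((b - a) * c).
Proof. exact (is_RInt_const (V := R_NormedModule) a b c). Qed.

Lemma is_RInt_sum_n (f : nat -> R -> R) (l : nat -> R) (a b : R) (N : nat) :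
  (forall n, is_RInt (f n) a b (l n)) ->
  is_RInt (fun x => sum_n (fun n => f n x) N) a b (sum_n l N).
Proof.
  intro H. induction N.
  - rewrite sum_n_zero. apply is_RInt_ext with (2 := H 0%nat).
    intros x _. rewrite sum_n_zero. reflexivity.
  - rewrite sum_n_succ.
    apply is_RInt_ext with (fun x => sum_n (fun n => f n x) N + f (S N) x).
    + intros x _. rewrite sum_n_succ. reflexivity.
    + apply is_RInt_plus_R; [exact IHN | apply H].
Qed.

Lemma series_tail_le (a M : nat -> R) (l L : R) (N : nat) :
  (forall n, Rabs (a n) <= M n) -> is_series a l -> is_series M L ->
  Rabs (l - sum_n a N) <= L - sum_n M N.
Proof.
  intros H Ha HM.
  assert (H' : forall n, - M n <= a n <= M n) by (intro n; apply Rabs_le_between, H).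
  apply Rabs_le. split.
  - assert (P : is_series (fun n => M n + a n) (L + l))
      by exact (is_series_plus (V := R_NormedModule) _ _ _ _ HM Ha).
    apply sum_n_le_series with (N := N) in P.
    + rewrite sum_n_plus_R in P. lra.
    + intro n. specialize (H' n). lra.
  - assert (P : is_series (fun n => M n + (-1) * a n) (L + (-1) * l)).
    { apply (is_series_plus (V := R_NormedModule) M (fun n => (-1) * a n)); [exact HM|].
      exact (is_series_scal (V := R_NormedModule) (-1) _ _ Ha). }
    apply sum_n_le_series with (N := N) in P.
    + rewrite sum_n_plus_R, sum_n_scal_R in P. lra.
    + intro n. specialize (H' n). lra.
Qed.

(** Domination by a convergent numerical series makes the convergence uniform,
    hence compatible with the integral. *)
Lemma is_series_RInt_dominated (f : nat -> R -> R) (s : R -> R) (M l : nat -> R)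
    (a b S : R) :
  a <= b ->
  (forall n, is_RInt (f n) a b (l n)) -> is_RInt s a b S ->
  (forall x, a <= x <= b -> is_series (fun n => f n x) (s x)) ->
  (forall n x, a <= x <= b -> Rabs (f n x) <= M n) -> ex_series M ->
  is_series l S.
Proof.
  intros Hab Hf Hs Hx HM [L HL]. apply is_series_lim.
  apply is_lim_seq_squeeze with (fun N => (b - a) * (L - sum_n M N)).
  - intro N.
    pose proof (is_RInt_minus_R _ _ _ _ _ _ Hs (is_RInt_sum_n f l a b N Hf)) as HD.
    rewrite <- Rabs_Ropp.
    replace (- (sum_n l N - S)) with (S - sum_n l N) by ring.
    refine (norm_RInt_le (V := R_NormedModule) _ _ _ _ _ _ Hab _ HD
              (is_RInt_const_R (L - sum_n M N) a b)).
    intros x H. apply series_tail_le.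
    + intro n. apply HM, H.
    + apply Hx, H.
    + exact HL.
  - replace (Finite 0) with (Finite ((b - a) * (L - L))) by (f_equal; ring).
    apply (is_lim_seq_scal_l _ (b - a) (L - L)).
    apply is_lim_seq_minus'; [apply is_lim_seq_const | exact HL].
Qed.

(** Integrating by parts moves one factor from [(1 - x)^m] to [x^p]. *)
Lemma is_RInt_beta (p m : nat) :
  is_RInt (fun x => x ^ p * (1 - x) ^ m) 0 1
    (INR (fact m)
     / fold_right Rmult 1 (map (fun i => INR (p + i)) (seq 1 (S m)))).
Proof.
  revert p. induction m as [|m IH]; intro p.
  - apply is_RInt_ext with (fun x => x ^ p).
    + intros x _. simpl. ring.
    + replace (INR (fact 0) / _) with (/ INR (S p)); [apply is_RInt_pow_unit|].
      simpl map. simpl fold_right. rewrite Nat.add_1_r. simpl (INR (fact 0)).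
      pose proof (INR_S_pos p). field. lra.
  - assert (E : fold_right Rmult 1 (map (fun i => INR (p + i)) (seq 1 (S (S m))))
      = INR (S p) * fold_right Rmult 1 (map (fun i => INR (S p + i)) (seq 1 (S m)))).
    { change (seq 1 (S (S m))) with (1%nat :: seq 2 (S m)).
      rewrite <- seq_shift. cbn [map fold_right]. rewrite map_map, Nat.add_1_r.
      do 2 f_equal. apply map_ext. intro i. f_equal. lia. }
    rewrite E. clear E. specialize (IH (S p)).
    set (Q := fold_right Rmult 1 (map (fun i => INR (S p + i)) (seq 1 (S m)))) in *.
    assert (HF : is_RInt (fun x => INR (S p) * (x ^ p * (1 - x) ^ S m)
                   - INR (S m) * (x ^ S p * (1 - x) ^ m)) 0 1
                (1 ^ S p * (1 - 1) ^ S m - 0 ^ S p * (1 - 0) ^ S m)).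
    { apply (is_RInt_derive (V := R_CompleteNormedModule)
               (fun x => x ^ S p * (1 - x) ^ S m)).
      - intros x _. auto_derive; [exact I|].
        change (match p with 0%nat => 1 | S _ => INR p + 1 end) with (INR (S p)).
        change (match m with 0%nat => 1 | S _ => INR m + 1 end) with (INR (S m)).
        unfold Rminus. simpl. ring.
      - intros x _. by_derive. }
    pose proof (is_RInt_scal_R (/ INR (S p)) _ _ _ _
      (is_RInt_plus_R _ _ _ _ _ _ HF (is_RInt_scal_R (INR (S m)) _ _ _ _ IH))) as HG.
    replace (INR (fact (S m)) / (INR (S p) * Q)) with
     (/ INR (S p) * (1 ^ S p * (1 - 1) ^ S m - 0 ^ S p * (1 - 0) ^ S m +
               INR (S m) * (INR (fact m) / Q))).
    + apply is_RInt_ext with (2 := HG). intros x _. real_eq.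
      pose proof (INR_S_pos p). field. lra.
    + change (fact (S m)) with (S m * fact m)%nat. rewrite mult_INR.
      replace (1 - 1) with 0 by ring. simpl pow.
      unfold Rdiv. rewrite Rinv_mult. ring.
Qed.

(** On (0,1] this is [1/x - PI/2 cot (PI x / 2)]; the power series form is also
    smooth at 0. *)
Definition cot_defect (x : R) : R := x / 2 * even_zeta_series (x ^ 2 / 4).

Lemma quarter_square_small (x : R) : 0 <= x <= 1 -> Rabs (x ^ 2 / 4) < 1.
Proof. intro Hx. rewrite Rabs_pos_eq; nra. Qed.

Lemma is_series_cot_defect (x : R) :
  0 <= x <= 1 ->
  is_series (fun j => zeta (INR (2 * S j)) / (2 * 4 ^ j) * x ^ (2 * j + 1))
    (cot_defect x).
Proof.
  intro Hx.
  assert (H : is_pseries (fun n => zeta (INR (2 * S n))) (x ^ 2 / 4)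
            (even_zeta_series (x ^ 2 / 4))).
  { apply PSeries_correct, CV_radius_inside, even_zeta_radius, quarter_square_small, Hx. }
  pose proof (is_series_scal (V := R_NormedModule) (x / 2) _ _ H) as H2.
  apply is_series_ext with (2 := H2). intro n.
  rewrite pow_n_pow. change (scal ?a ?b) with (a * b). real_eq.
  change (scal ((x ^ 2 / 4) ^ n) (zeta (INR (2 * S n)))) with
    ((x ^ 2 / 4) ^ n * zeta (INR (2 * S n))).
  unfold Rdiv. rewrite Rpow_mult_distr, pow_inv, <- pow_mult, Rinv_mult, pow_add.
  simpl (x ^ 1). ring.
Qed.

Lemma is_derive_even_zeta_quarter_square (x : R) :
  0 <= x <= 1 ->
  is_derive (fun x => even_zeta_series (x ^ 2 / 4)) x
    (x / 2 * PSeries (PS_derive (fun n => zeta (INR (2 * S n)))) (x ^ 2 / 4)).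
Proof.
  intro Hx.
  apply (is_derive_comp (V := R_NormedModule) even_zeta_series (fun x => x ^ 2 / 4)).
  - apply is_derive_PSeries, even_zeta_radius, quarter_square_small, Hx.
  - auto_derive; [exact I|]. field.
Qed.

Lemma continuous_cot_defect (x : R) : 0 <= x <= 1 -> continuous cot_defect x.
Proof.
  intro Hx. apply (continuous_mult (K := R_AbsRing) (fun x => x / 2)
    (fun x => even_zeta_series (x ^ 2 / 4))).
  - by_derive.
  - eapply continuous_of_derive, is_derive_even_zeta_quarter_square, Hx.
Qed.

Lemma is_RInt_cot_defect : is_RInt cot_defect 0 1 (ln (PI / 2)).
Proof.
  replace (ln (PI / 2)) with
    (PSeries log_coef (1 ^ 2 / 4) - PSeries log_coef (0 ^ 2 / 4)).
  - apply (is_RInt_derive (V := R_CompleteNormedModule)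
             (fun x => PSeries log_coef (x ^ 2 / 4))).
    + intros x Hx. rewrite Rmin_left, Rmax_right in Hx by lra.
      apply (is_derive_comp (V := R_NormedModule) (PSeries log_coef) (fun x => x ^ 2 / 4)).
      * apply is_derive_log_series, quarter_square_small, Hx.
      * auto_derive; [exact I|]. field.
    + intros x Hx. rewrite Rmin_left, Rmax_right in Hx by lra.
      apply continuous_cot_defect, Hx.
  - replace (1 ^ 2 / 4) with ((1 / 2) ^ 2) by field.
    replace (0 ^ 2 / 4) with 0 by field.
    rewrite log_series_sine, PSeries_0 by lra.
    replace (PI * (1 / 2)) with (PI / 2) by field.
    rewrite sin_PI2, ln_1. simpl. ring.
Qed.

Definition moment (m : nat) : R := RInt (fun x => (1 - x) ^ m * cot_defect x) 0 1.

Lemma is_RInt_moment (m : nat) :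
  is_RInt (fun x => (1 - x) ^ m * cot_defect x) 0 1 (moment m).
Proof.
  apply (RInt_correct (V := R_CompleteNormedModule)),
    (ex_RInt_continuous (V := R_CompleteNormedModule)).
  intros x Hx. rewrite Rmin_left, Rmax_right in Hx by lra.
  apply (continuous_mult (K := R_AbsRing) (fun x => (1 - x) ^ m) cot_defect).
  - by_derive.
  - apply continuous_cot_defect, Hx.
Qed.

Lemma rising_prod_pos (n m : nat) : (1 <= n)%nat -> 0 < rising_prod n m.
Proof.
  intro Hn. unfold rising_prod. induction (seq 1 m) as [|i s IH]; simpl map; simpl fold_right.
  - lra.
  - apply Rmult_lt_0_compat; [apply lt_0_INR; lia | exact IH].
Qed.

(** The coefficient of [zeta (2n)] is a Beta integral: since
    [n (2n+1)...(2n+m)] is half of [2n (2n+1)...(2n+m)], the series is the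
    integral of the expansion of [cot_defect] against [(1 - x)^m / m!]. *)
Lemma moment_series (m : nat) :
  is_series
    (fun j => zeta (INR (2 * S j)) / (INR (S j) * rising_prod (S j) m * 4 ^ S j))
    (/ INR (fact m) * moment m).
Proof.
  pose proof (INR_fact_lt_0 m) as Hm.
  assert (H : is_series (fun j => zeta (INR (2 * S j)) / (2 * 4 ^ j)
      * (INR (fact m) / (2 * INR (S j) * rising_prod (S j) m))) (moment m)).
  { apply (is_series_RInt_dominated
      (fun j x => zeta (INR (2 * S j)) / (2 * 4 ^ j) * (x ^ (2 * j + 1) * (1 - x) ^ m))
      (fun x => (1 - x) ^ m * cot_defect x)
      (fun j => zeta (INR (2 * S j)) / (2 * 4 ^ j) * 1 ^ (2 * j + 1))
      _ 0 1 (moment m)).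
    - lra.
    - intro j. apply is_RInt_scal_R.
      replace (2 * INR (S j) * rising_prod (S j) m) with
       (fold_right Rmult 1 (map (fun i => INR (2 * j + 1 + i)) (seq 1 (S m)))).
      + apply is_RInt_beta.
      + change (seq 1 (S m)) with (1%nat :: seq 2 m).
        rewrite <- seq_shift. cbn [map fold_right]. rewrite map_map.
        unfold rising_prod. f_equal.
        * replace (2 * j + 1 + 1)%nat with (2 * S j)%nat by lia.
          rewrite mult_INR. reflexivity.
        * f_equal. apply map_ext. intro i. f_equal. lia.
    - apply is_RInt_moment.
    - intros x Hx.
      pose proof (is_series_scal (V := R_NormedModule) ((1 - x) ^ m) _ _
        (is_series_cot_defect x Hx)) as HS.
      apply is_series_ext with (2 := HS). intro n.
      change (scal ?a ?b) with (a * b). real_ring.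
    - intros j x Hx.
      assert (0 <= zeta (INR (2 * S j)) / (2 * 4 ^ j)).
      { apply Rmult_le_pos; [apply even_zeta_bound|]. left. apply Rinv_0_lt_compat.
        pose proof (pow_lt 4 j). lra. }
      assert (forall n t, 0 <= t <= 1 -> 0 <= t ^ n <= 1) as HP.
      { intros n t Ht. split; [apply pow_le; lra|].
        rewrite <- (pow1 n). apply pow_incr. lra. }
      pose proof (HP (2 * j + 1)%nat x Hx). pose proof (HP m (1 - x) ltac:(lra)).
      rewrite pow1, Rabs_pos_eq.
      + apply Rmult_le_compat_l; [assumption | nra].
      + apply Rmult_le_pos; [assumption | nra].
    - exists (cot_defect 1). apply is_series_cot_defect. lra. }
  pose proof (is_series_scal (V := R_NormedModule) (/ INR (fact m)) _ _ H) as HS.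
  apply is_series_ext with (2 := HS). intro j. change (scal ?a ?b) with (a * b).
  real_eq. pose proof (INR_S_pos j). pose proof (rising_prod_pos (S j) m ltac:(lia)).
  pose proof (pow_lt 4 j ltac:(lra)). simpl pow. field. repeat split; lra.
Qed.

(** * The sine expansion of the cotangent *)

Definition C1_unit (f : R -> R) : Prop :=
  exists df : R -> R, forall x, 0 <= x <= 1 -> is_derive f x (df x) /\ continuous df x.

Lemma C1_unit_continuous (f : R -> R) (x : R) :
  C1_unit f -> 0 <= x <= 1 -> continuous f x.
Proof.
  intros [df H] Hx. eapply continuous_of_derive, (proj1 (H x Hx)).
Qed.

Lemma C1_unit_ext (f g : R -> R) : (forall x, f x = g x) -> C1_unit f -> C1_unit g.
Proof.
  intros E [df H]. exists df. intros x Hx. split; [|apply H, Hx].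
  apply (is_derive_ext f); [exact E | apply H, Hx].
Qed.

Lemma C1_unit_plus (f g : R -> R) :
  C1_unit f -> C1_unit g -> C1_unit (fun x => f x + g x).
Proof.
  intros [df Hf] [dg Hg]. exists (fun x => df x + dg x). intros x Hx.
  destruct (Hf x Hx), (Hg x Hx). split.
  - apply (is_derive_plus (V := R_NormedModule) f g); assumption.
  - apply (continuous_plus (V := R_NormedModule) df dg); assumption.
Qed.

Lemma C1_unit_mult (f g : R -> R) :
  C1_unit f -> C1_unit g -> C1_unit (fun x => f x * g x).
Proof.
  intros Cf Cg. pose proof (C1_unit_continuous f) as Kf.
  pose proof (C1_unit_continuous g) as Kg.
  specialize (fun x => Kf x Cf). specialize (fun x => Kg x Cg).
  destruct Cf as [df Hf], Cg as [dg Hg].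
  exists (fun x => df x * g x + f x * dg x). intros x Hx.
  destruct (Hf x Hx), (Hg x Hx). split.
  - apply (is_derive_mult (K := R_AbsRing) f g); try assumption. exact Rmult_comm.
  - apply (continuous_plus (V := R_NormedModule) (fun x => df x * g x) (fun x => f x * dg x)).
    + apply (continuous_mult (K := R_AbsRing) df g); auto.
    + apply (continuous_mult (K := R_AbsRing) f dg); auto.
Qed.

Lemma C1_unit_pow (n : nat) : C1_unit (fun x => (1 - x) ^ n).
Proof.
  exists (fun x => - (INR n * (1 - x) ^ pred n)). intros x _. split.
  - auto_derive; [exact I|]. unfold Rminus. ring.
  - by_derive.
Qed.

Lemma C1_unit_affine (a b : R) : C1_unit (fun x => a * x + b).
Proof.
  exists (fun _ => a). intros x _. split.
  - auto_derive; [exact I | ring].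
  - apply continuous_const.
Qed.

Lemma C1_unit_sum_n (f : nat -> R -> R) (N : nat) :
  (forall n, C1_unit (f n)) -> C1_unit (fun x => sum_n (fun n => f n x) N).
Proof.
  intro H. induction N.
  - apply C1_unit_ext with (2 := H 0%nat). intro x. rewrite sum_n_zero. reflexivity.
  - apply C1_unit_ext with (fun x => sum_n (fun n => f n x) N + f (S N) x).
    + intro x. rewrite sum_n_succ. reflexivity.
    + apply C1_unit_plus; [exact IHN | apply H].
Qed.

Lemma C1_unit_cot_defect : C1_unit cot_defect.
Proof.
  apply C1_unit_mult.
  - apply C1_unit_ext with (2 := C1_unit_affine (/ 2) 0). intro x. field.
  - exists (fun x => x / 2 * PSeries (PS_derive (fun n => zeta (INR (2 * S n)))) (x ^ 2 / 4)).
    intros x Hx. split.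
    + apply is_derive_even_zeta_quarter_square, Hx.
    + apply (continuous_mult (K := R_AbsRing) (fun x => x / 2)
        (fun x => PSeries (PS_derive (fun n => zeta (INR (2 * S n)))) (x ^ 2 / 4))).
      * by_derive.
      * apply (continuous_comp (fun x => x ^ 2 / 4)
           (PSeries (PS_derive (fun n => zeta (INR (2 * S n)))))).
        -- by_derive.
        -- apply continuity_pt_filterlim, PSeries_continuity.
           rewrite CV_radius_derive. apply even_zeta_radius, quarter_square_small, Hx.
Qed.

Lemma ex_RInt_mult_cos (f : R -> R) (w p : R) :
  C1_unit f -> ex_RInt (fun x => f x * cos (w * x + p)) 0 1.
Proof.
  intro H. apply (ex_RInt_continuous (V := R_CompleteNormedModule)).
  intros x Hx. rewrite Rmin_left, Rmax_right in Hx by lra.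
  apply (continuous_mult (K := R_AbsRing) f (fun x => cos (w * x + p))).
  - apply C1_unit_continuous; assumption.
  - by_derive.
Qed.

(** Integration by parts gains a factor [1/w], where [w = (N+1) PI], against a
    bounded remainder.  The phase [p] makes one statement serve cosine and sine. *)
Lemma riemann_lebesgue (f : R -> R) (p : R) :
  C1_unit f ->
  is_lim_seq (fun N => RInt (fun x => f x * cos (INR (S N) * PI * x + p)) 0 1) 0.
Proof.
  intros [df H].
  assert (Hex : ex_RInt df 0 1).
  { apply (ex_RInt_continuous (V := R_CompleteNormedModule)).
    intros x Hx. rewrite Rmin_left, Rmax_right in Hx by lra. apply H, Hx. }
  apply (ex_RInt_norm) in Hex. destruct Hex as [D HD].
  apply is_lim_seq_squeeze with
    (fun N => (Rabs (f 1) + Rabs (f 0) + D) / INR (S N)).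
  2: apply is_lim_seq_div_INR.
  intro N. rewrite Rminus_0_r. set (w := INR (S N) * PI).
  assert (Hw : INR (S N) <= w).
  { unfold w. pose proof (INR_S_pos N). pose proof PI2_1. nra. }
  assert (Hn : 0 < INR (S N)) by apply INR_S_pos.
  assert (HF : is_RInt (fun x => df x * (sin (w * x + p) / w) + f x * cos (w * x + p)) 0 1
      (f 1 * (sin (w * 1 + p) / w) - f 0 * (sin (w * 0 + p) / w))).
  { apply (is_RInt_derive (V := R_CompleteNormedModule) (fun x => f x * (sin (w * x + p) / w))).
    - intros x Hx. rewrite Rmin_left, Rmax_right in Hx by lra.
      apply (is_derive_mult (K := R_AbsRing) f (fun x => sin (w * x + p) / w)).
      + apply H, Hx.
      + auto_derive; [exact I|]. field. lra.
      + exact Rmult_comm.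
    - intros x Hx. rewrite Rmin_left, Rmax_right in Hx by lra.
      apply (continuous_plus (V := R_NormedModule)
        (fun x => df x * (sin (w * x + p) / w)) (fun x => f x * cos (w * x + p))).
      + apply (continuous_mult (K := R_AbsRing) df (fun x => sin (w * x + p) / w)).
        * apply H, Hx.
        * by_derive.
      + apply (continuous_mult (K := R_AbsRing) f (fun x => cos (w * x + p))).
        * eapply continuous_of_derive, H, Hx.
        * by_derive. }
  assert (HC : is_RInt (fun x => f x * cos (w * x + p)) 0 1
       (RInt (fun x => f x * cos (w * x + p)) 0 1)).
  { apply (RInt_correct (V := R_CompleteNormedModule)), ex_RInt_mult_cos.
    exists df. exact H. }
  set (J := RInt (fun x => f x * cos (w * x + p)) 0 1) in *.
  set (Bd := f 1 * (sin (w * 1 + p) / w) - f 0 * (sin (w * 0 + p) / w)) in *.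
  assert (HS : is_RInt (fun x => df x * (sin (w * x + p) / w)) 0 1 (Bd - J)).
  { apply is_RInt_ext with (2 := is_RInt_minus_R _ _ _ _ _ _ HF HC).
    intros x _. real_ring. }
  assert (Hsin : forall t, Rabs (sin t / w) <= / INR (S N)).
  { intro t. unfold Rdiv. rewrite Rabs_mult.
    assert (Rabs (sin t) <= 1) by (apply Rabs_le, SIN_bound).
    assert (Rabs (/ w) <= / INR (S N)).
    { rewrite Rabs_pos_eq by (left; apply Rinv_0_lt_compat; lra).
      apply Rinv_le_contravar; lra. }
    pose proof (Rabs_pos (sin t)). pose proof (Rabs_pos (/ w)). nra. }
  assert (B1 : Rabs (Bd - J) <= / INR (S N) * D).
  { refine (norm_RInt_le (V := R_NormedModule) _ _ _ _ _ _ Rle_0_1 _ HS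
              (is_RInt_scal_R (/ INR (S N)) _ _ _ _ HD)).
    intros x Hx. change (Rabs (df x * (sin (w * x + p) / w)) <= / INR (S N) * Rabs (df x)).
    rewrite Rabs_mult, Rmult_comm.
    apply Rmult_le_compat_r; [apply Rabs_pos | apply Hsin]. }
  assert (B2 : Rabs Bd <= / INR (S N) * (Rabs (f 1) + Rabs (f 0))).
  { unfold Bd, Rminus. apply Rle_trans with (1 := Rabs_triang _ _).
    rewrite Rabs_Ropp, !Rabs_mult, Rmult_plus_distr_l, !(Rmult_comm (/ INR (S N))).
    apply Rplus_le_compat; apply Rmult_le_compat_l; auto using Rabs_pos. }
  replace J with (Bd - (Bd - J)) by ring.
  pose proof (Rabs_triang Bd (- (Bd - J))) as T. rewrite Rabs_Ropp in T.
  unfold Rminus at 1. unfold Rdiv. lra.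
Qed.

(** Telescoping of [2 sin h sin b = cos (b - h) - cos (b + h)] with [h = t/2].  In
    this form the right side splits into a half cotangent plus two oscillating
    terms after division by [2 sin (t/2)]. *)
Lemma sine_sum (t : R) (N : nat) :
  2 * sin (t / 2) * sum_n (fun k => sin (INR (S k) * t)) N
  = cos (t / 2) * (1 - cos (INR (S N) * t)) + sin (t / 2) * sin (INR (S N) * t).
Proof.
  induction N.
  - rewrite sum_n_zero. simpl INR. rewrite Rmult_1_l.
    set (h := t / 2). replace t with (2 * h) by (unfold h; field).
    rewrite sin_2a, cos_2a_sin. ring.
  - rewrite sum_n_succ, Rmult_plus_distr_l, IHN.
    set (h := t / 2). set (b := INR (S (S N)) * t).
    replace (INR (S N) * t) with (b - 2 * h)
      by (unfold b, h; rewrite (S_INR (S N)); field).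
    assert (E1 : cos h * cos (b - 2 * h) - sin h * sin (b - 2 * h) = cos (b - h)).
    { rewrite <- cos_plus. f_equal. ring. }
    assert (E2 : cos h * cos b - sin h * sin b = cos (b + h)).
    { rewrite <- cos_plus. f_equal. ring. }
    assert (E3 : cos (b - h) - cos (b + h) = 2 * sin b * sin h)
      by (rewrite cos_minus, cos_plus; ring).
    lra.
Qed.

Definition geometric_factor (p : nat) (x : R) : R := sum_n (fun i => (1 - x) ^ i) p.

Lemma mul_geometric_factor (p : nat) (x : R) :
  x * geometric_factor p x = 1 - (1 - x) ^ S p.
Proof.
  unfold geometric_factor. induction p.
  - rewrite sum_n_zero. simpl. ring.
  - rewrite sum_n_succ, Rmult_plus_distr_l, IHp. simpl. ring.
Qed.

Lemma is_RInt_geometric_factor (p : nat) :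
  is_RInt (geometric_factor p) 0 1 (harmonic (S p)).
Proof.
  unfold harmonic. rewrite <- sum_n_m_S. fold (sum_n (fun i => / INR (S i)) p).
  apply (is_RInt_sum_n (fun i x => (1 - x) ^ i)). intro i.
  replace (/ INR (S i)) with
    (- ((1 - 1) ^ S i / INR (S i)) - - ((1 - 0) ^ S i / INR (S i))).
  - apply (is_RInt_derive (V := R_CompleteNormedModule)
             (fun x => - ((1 - x) ^ S i / INR (S i)))).
    + intros x _. auto_derive; [exact I|].
      change (match i with 0%nat => 1 | S _ => INR i + 1 end) with (INR (S i)).
      pose proof (INR_S_pos i). unfold Rminus. field. lra.
    + intros x _. by_derive.
  - rewrite Rminus_0_r, pow1. replace (1 - 1) with 0 by ring.
    pose proof (INR_S_pos i). simpl pow. field. lra.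
Qed.

Lemma C1_unit_main_factor (p : nat) :
  C1_unit (fun x => geometric_factor p x * (1 - x * cot_defect x)).
Proof.
  apply C1_unit_mult.
  - apply (C1_unit_sum_n (fun i x => (1 - x) ^ i)), C1_unit_pow.
  - apply C1_unit_ext with (fun x => (0 * x + 1) + (-1 * x + 0) * cot_defect x).
    + intro x. ring.
    + apply C1_unit_plus; [|apply C1_unit_mult]; auto using C1_unit_affine, C1_unit_cot_defect.
Qed.

Lemma C1_unit_weight (p : nat) : C1_unit (fun x => 1 - (1 - x) ^ S p).
Proof.
  apply C1_unit_ext with (fun x => (1 * x + 0) * geometric_factor p x).
  - intro x. rewrite <- mul_geometric_factor. ring.
  - apply C1_unit_mult; [apply C1_unit_affine|].
    apply (C1_unit_sum_n (fun i x => (1 - x) ^ i)), C1_unit_pow.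
Qed.

Definition sine_moment (m k : nat) : R :=
  RInt (fun x => (1 - x) ^ m * sin (INR (S k) * PI * x)) 0 1.

Lemma is_RInt_sine_moment (m k : nat) :
  is_RInt (fun x => (1 - x) ^ m * sin (INR (S k) * PI * x)) 0 1 (sine_moment m k).
Proof.
  apply (RInt_correct (V := R_CompleteNormedModule)),
    (ex_RInt_continuous (V := R_CompleteNormedModule)).
  intros x _. by_derive.
Qed.

(** By [sine_sum] and [even_zeta_cotangent], for [W = 1 - (1-x)^(p+1)], which
    vanishes at 0, the product of [PI W] and the sum of the [sin (k PI x)] is
    [G - G cos (w x) + PI/2 W sin (w x)], where [w = (N+1) PI] and
    [G = PI/2 W cot (PI x / 2) = W / x - W cot_defect]; the last sine is written
    as a shifted cosine. *)
Lemma sine_moment_partial_sum (p N : nat) :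
  sum_n (fun k => PI * (sine_moment 0 k - sine_moment (S p) k)) N
  = (moment (S p) - ln (PI / 2) + harmonic (S p))
    - RInt (fun x => geometric_factor p x * (1 - x * cot_defect x)
                     * cos (INR (S N) * PI * x + 0)) 0 1
    + PI / 2 * RInt (fun x => (1 - (1 - x) ^ S p)
                     * cos (INR (S N) * PI * x + - (PI / 2))) 0 1.
Proof.
  pose proof PI_RGT_0 as HPI.
  set (W := fun x => 1 - (1 - x) ^ S p).
  set (G := fun x => geometric_factor p x * (1 - x * cot_defect x)).
  assert (CG : C1_unit G) by apply C1_unit_main_factor.
  assert (CW : C1_unit W) by apply C1_unit_weight.
  assert (HG : is_RInt G 0 1 (moment (S p) - ln (PI / 2) + harmonic (S p))).
  { apply is_RInt_ext with (fun x =>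
      ((1 - x) ^ S p * cot_defect x - cot_defect x) + geometric_factor p x).
    - intros x _. unfold G.
      replace (geometric_factor p x * (1 - x * cot_defect x)) with
        (geometric_factor p x - (x * geometric_factor p x) * cot_defect x) by ring.
      rewrite mul_geometric_factor. real_ring.
    - apply is_RInt_plus_R; [|apply is_RInt_geometric_factor].
      apply is_RInt_minus_R; [apply is_RInt_moment | apply is_RInt_cot_defect]. }
  assert (HR : is_RInt (fun x =>
      (G x - G x * cos (INR (S N) * PI * x + 0))
      + PI / 2 * (W x * cos (INR (S N) * PI * x + - (PI / 2)))) 0 1
    (moment (S p) - ln (PI / 2) + harmonic (S p)
     - RInt (fun x => G x * cos (INR (S N) * PI * x + 0)) 0 1
     + PI / 2 * RInt (fun x => W x * cos (INR (S N) * PI * x + - (PI / 2))) 0 1)).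
  { apply is_RInt_plus_R; [apply is_RInt_minus_R; [exact HG|] | apply is_RInt_scal_R];
    apply (RInt_correct (V := R_CompleteNormedModule)), ex_RInt_mult_cos; assumption. }
  assert (HL : is_RInt (fun x => sum_n (fun k =>
      PI * ((1 - x) ^ 0 * sin (INR (S k) * PI * x)
            - (1 - x) ^ S p * sin (INR (S k) * PI * x))) N) 0 1
    (sum_n (fun k => PI * (sine_moment 0 k - sine_moment (S p) k)) N)).
  { apply (is_RInt_sum_n (fun k x =>
      PI * ((1 - x) ^ 0 * sin (INR (S k) * PI * x)
            - (1 - x) ^ S p * sin (INR (S k) * PI * x)))).
    intro k. apply is_RInt_scal_R, is_RInt_minus_R; apply is_RInt_sine_moment. }
  refine (eq_trans (eq_sym (is_RInt_unique _ _ _ _ HL))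
                   (eq_trans _ (is_RInt_unique _ _ _ _ HR))).
  apply RInt_ext. intros x Hx. rewrite Rmin_left, Rmax_right in Hx by lra.
  real_eq.
  rewrite (sum_n_ext _ (fun k => (PI * W x) * sin (INR (S k) * (PI * x)))).
  2: { intro k. real_eq. rewrite !Rmult_assoc. unfold W. simpl. ring. }
  rewrite sum_n_scal_R.
  assert (Hs : 0 < sin (PI * x / 2)) by (apply sin_gt_0; nra).
  pose proof (sine_sum (PI * x) N) as HS.
  pose proof (even_zeta_cotangent (x / 2) ltac:(lra)) as HC.
  replace ((x / 2) ^ 2) with (x ^ 2 / 4) in HC by field.
  replace (PI * (x / 2)) with (PI * x / 2) in HC by field.
  assert (HGs : 2 * sin (PI * x / 2) * G x = PI * W x * cos (PI * x / 2)).
  { unfold G, W. rewrite <- mul_geometric_factor. unfold cot_defect.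
    replace (2 * sin (PI * x / 2)
       * (geometric_factor p x * (1 - x * (x / 2 * even_zeta_series (x ^ 2 / 4)))))
    with (2 * geometric_factor p x * (sin (PI * x / 2) *
       (1 - 2 * (x ^ 2 / 4) * even_zeta_series (x ^ 2 / 4)))) by field.
    rewrite HC. field. }
  rewrite Rplus_0_r.
  replace (cos (INR (S N) * PI * x + - (PI / 2))) with (sin (INR (S N) * (PI * x))).
  2: { rewrite cos_plus, cos_neg, sin_neg, cos_PI2, sin_PI2, Rmult_assoc. ring. }
  rewrite Rmult_assoc with (r1 := INR (S N)).
  apply Rmult_eq_reg_l with (2 * sin (PI * x / 2)); [|lra].
  transitivity (PI * W x * (2 * sin (PI * x / 2)
     * sum_n (fun k => sin (INR (S k) * (PI * x))) N)); [ring|].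
  rewrite HS.
  transitivity (2 * sin (PI * x / 2) * G x * (1 - cos (INR (S N) * (PI * x)))
    + 2 * sin (PI * x / 2) * (PI / 2 * (W x * sin (INR (S N) * (PI * x))))); [|ring].
  rewrite HGs. field.
Qed.

Lemma sine_moment_series (p : nat) :
  is_series (fun k => PI * (sine_moment 0 k - sine_moment (S p) k))
    (moment (S p) - ln (PI / 2) + harmonic (S p)).
Proof.
  apply is_series_lim.
  set (l := moment (S p) - ln (PI / 2) + harmonic (S p)).
  eapply is_lim_seq_ext; [intro N; symmetry; apply sine_moment_partial_sum|].
  fold l. replace (Finite l) with (Finite (l - 0 + PI / 2 * 0)) by (f_equal; ring).
  apply is_lim_seq_plus'; [apply is_lim_seq_minus'; [apply is_lim_seq_const|] |
    apply (is_lim_seq_scal_l _ (PI / 2) 0)].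
  - apply riemann_lebesgue, C1_unit_main_factor.
  - apply riemann_lebesgue, C1_unit_weight.
Qed.

(** * Evaluation of the Fourier side *)

Lemma cos_INR_PI (n : nat) : cos (INR n * PI) = (-1) ^ n.
Proof.
  induction n.
  - simpl. rewrite Rmult_0_l. apply cos_0.
  - rewrite S_INR, Rmult_plus_distr_r, Rmult_1_l, neg_cos, IHn. simpl. ring.
Qed.

Lemma sin_INR_PI (n : nat) : sin (INR n * PI) = 0.
Proof.
  induction n.
  - simpl. rewrite Rmult_0_l. apply sin_0.
  - rewrite S_INR, Rmult_plus_distr_r, Rmult_1_l, neg_sin, IHn. ring.
Qed.

Lemma freq_pos (k : nat) : 0 < INR (S k) * PI.
Proof. apply Rmult_lt_0_compat; [apply INR_S_pos | apply PI_RGT_0]. Qed.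

Lemma sine_moment_0 (k : nat) :
  sine_moment 0 k = (1 - (-1) ^ S k) / (INR (S k) * PI).
Proof.
  apply is_RInt_unique. pose proof (freq_pos k) as Hw. rewrite <- cos_INR_PI.
  set (w := INR (S k) * PI) in *.
  replace ((1 - cos w) / w) with (- cos (w * 1) / w - - cos (w * 0) / w)
    by (rewrite Rmult_1_r, Rmult_0_r, cos_0; field; lra).
  apply (is_RInt_derive (V := R_CompleteNormedModule) (fun x => - cos (w * x) / w)).
  - intros x _. auto_derive; [exact I|]. simpl. field. lra.
  - intros x _. by_derive.
Qed.

Lemma sine_moment_1 (k : nat) : sine_moment 1 k = / (INR (S k) * PI).
Proof.
  apply is_RInt_unique. pose proof (freq_pos k) as Hw.
  pose proof (sin_INR_PI (S k)) as Hs. set (w := INR (S k) * PI) in *.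
  pose (F := fun x => - (1 - x) * cos (w * x) / w - sin (w * x) / w ^ 2).
  replace (/ w) with (F 1 - F 0).
  2: { unfold F. rewrite Rmult_1_r, Rmult_0_r, cos_0, sin_0, Hs. field. lra. }
  apply (is_RInt_derive (V := R_CompleteNormedModule) F).
  - intros x _. unfold F. auto_derive; [exact I|]. unfold Rminus. field. lra.
  - intros x _. by_derive.
Qed.

(** Two integrations by parts. *)
Lemma sine_moment_rec (m k : nat) :
  sine_moment (S (S m)) k
  = / (INR (S k) * PI)
    - INR (S (S m)) * INR (S m) / (INR (S k) * PI) ^ 2 * sine_moment m k.
Proof.
  pose proof (freq_pos k) as Hw.
  pose proof (is_RInt_sine_moment (S (S m)) k) as H2.
  pose proof (is_RInt_sine_moment m k) as H0.
  set (w := INR (S k) * PI) in *.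
  pose (F := fun x => - (1 - x) ^ S (S m) * cos (w * x) / w
                      - INR (S (S m)) * (1 - x) ^ S m * sin (w * x) / w ^ 2).
  assert (H : is_RInt (fun x => (1 - x) ^ S (S m) * sin (w * x)
      + INR (S (S m)) * INR (S m) / w ^ 2 * ((1 - x) ^ m * sin (w * x))) 0 1 (F 1 - F 0)).
  { apply (is_RInt_derive (V := R_CompleteNormedModule) F).
    - intros x _. unfold F. auto_derive; [exact I|].
      change (match m with 0%nat => 1 | S _ => INR m + 1 end) with (INR (S m)).
      change (INR (S m) + 1) with (INR (S (S m))).
      unfold Rminus. simpl pow. field. lra.
    - intros x _. by_derive. }
  pose proof (eq_trans (eq_sym (is_RInt_unique _ _ _ _ H))
    (is_RInt_unique _ _ _ _ (is_RInt_plus_R _ _ _ _ _ _ H2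
      (is_RInt_scal_R (INR (S (S m)) * INR (S m) / w ^ 2) _ _ _ _ H0)))) as E.
  assert (EF : F 1 - F 0 = / w).
  { unfold F. rewrite Rmult_0_r, cos_0, sin_0, Rminus_0_r, pow1.
    replace (1 - 1) with 0 by ring. simpl pow. field. lra. }
  lra.
Qed.

(** What is left of the [k]-th term of [sine_moment_series], divided by [m!],
    once the term of the alternating harmonic series is removed. *)
Definition fourier_term (m k : nat) : R :=
  (/ INR (S k) - PI * sine_moment m k) / INR (fact m).

Lemma fourier_term_rec (m k : nat) :
  fourier_term (S (S m)) k
  = / (INR (fact m) * PI ^ 2 * INR (S k) ^ 3)
    - fourier_term m k / (PI ^ 2 * INR (S k) ^ 2).
Proof.
  unfold fourier_term. rewrite sine_moment_rec.
  change (fact (S (S m))) with (S (S m) * (S m * fact m))%nat.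
  rewrite !mult_INR. pose proof (INR_fact_lt_0 m). pose proof (INR_S_pos k).
  pose proof (INR_S_pos m). pose proof (INR_S_pos (S m)). pose proof PI_RGT_0.
  field. repeat split; lra.
Qed.

(** The alternating harmonic series turns [ln (PI / 2)] into [ln PI]. *)
Lemma fourier_term_series (p : nat) :
  is_series (fourier_term (S p))
    (/ INR (fact (S p)) * moment (S p) - (ln PI - harmonic (S p)) / INR (fact (S p))).
Proof.
  pose proof (INR_fact_lt_0 (S p)) as Hf. pose proof PI_RGT_0 as HPI.
  pose proof (is_series_minus (V := R_NormedModule) _ _ _ _
                (sine_moment_series p) alternating_harmonic_series) as H.
  apply (is_series_scal (V := R_NormedModule) (/ INR (fact (S p)))) in H.
  match type of H with is_series _ ?l =>
    replace (_ - _) with l end.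
  - apply is_series_ext with (2 := H). intro k.
    change (/ INR (fact (S p)) * (PI * (sine_moment 0 k - sine_moment (S p) k)
       - - (-1) ^ S k / INR (S k)) = fourier_term (S p) k).
    unfold fourier_term. rewrite sine_moment_0. pose proof (INR_S_pos k).
    field. repeat split; lra.
  - change (/ INR (fact (S p)) * ((moment (S p) - ln (PI / 2) + harmonic (S p)) - ln 2)
     = / INR (fact (S p)) * moment (S p) - (ln PI - harmonic (S p)) / INR (fact (S p))).
    rewrite (ln_div PI 2 HPI Rlt_0_2). field. lra.
Qed.

Definition zeta_coef (m j : nat) : R :=
  (-1) ^ j / (INR (fact (m - 2 * j)) * PI ^ (2 * j)).

(** [fourier_term_rec] unrolled [p] times.  It will be used with [r = 1] and
    [r = 2], where the remaining term is 0, respectively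
    supported on the odd values of [S k]. *)
Lemma fourier_term_closed (r p k : nat) :
  fourier_term (2 * p + r) k
  = (-1) ^ p / (PI ^ (2 * p) * INR (S k) ^ (2 * p)) * fourier_term r k
    - sum_n_m (fun j => zeta_coef (2 * p + r) j * / INR (S k) ^ (2 * j + 1)) 1 p.
Proof.
  pose proof (INR_S_pos k) as Hk. pose proof PI_RGT_0 as HPI.
  induction p.
  - rewrite sum_n_m_zero by lia. change (@zero R_AbelianMonoid) with 0. simpl. field.
  - replace (2 * S p + r)%nat with (S (S (2 * p + r))) by lia.
    rewrite fourier_term_rec, IHp.
    rewrite (sum_Sn_m _ 1 (S p)) by lia. change (plus ?a ?b) with (a + b).
    rewrite <- sum_n_m_S.
    assert (E : sum_n_m (fun j => zeta_coef (S (S (2 * p + r))) (S j)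
                          * / INR (S k) ^ (2 * S j + 1)) 1 p
      = - / (PI ^ 2 * INR (S k) ^ 2)
        * sum_n_m (fun j => zeta_coef (2 * p + r) j * / INR (S k) ^ (2 * j + 1)) 1 p).
    { rewrite <- (sum_n_m_mult_l (K := R_Ring) (- / (PI ^ 2 * INR (S k) ^ 2))).
      apply sum_n_m_ext. intro j. change (mult ?a ?b) with (a * b).
      real_eq. unfold zeta_coef.
      replace (S (S (2 * p + r)) - 2 * S j)%nat with (2 * p + r - 2 * j)%nat by lia.
      replace (2 * S j)%nat with (2 * j + 2)%nat by lia.
      rewrite !pow_add. pose proof (INR_fact_lt_0 (2 * p + r - 2 * j)).
      assert (PI ^ (2 * j) <> 0) by (apply pow_nonzero; lra).
      assert (INR (S k) ^ (2 * j) <> 0) by (apply pow_nonzero; lra).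
      simpl ((-1) ^ S j). field. repeat split; try assumption; lra. }
    rewrite E. clear E. unfold zeta_coef at 2.
    replace (S (S (2 * p + r)) - 2 * 1)%nat with (2 * p + r)%nat by lia.
    replace (2 * S p)%nat with (2 * p + 2)%nat by lia.
    rewrite !pow_add. pose proof (INR_fact_lt_0 (2 * p + r)).
    assert (PI ^ (2 * p) <> 0) by (apply pow_nonzero; lra).
    assert (INR (S k) ^ (2 * p) <> 0) by (apply pow_nonzero; lra).
    set (X := sum_n_m _ 1 p). simpl ((-1) ^ S p). simpl ((-1) ^ 1). simpl (2 * 1)%nat.
    field. repeat split; try assumption; lra.
Qed.

Lemma fourier_term_1 (k : nat) : fourier_term 1 k = 0.
Proof.
  unfold fourier_term. rewrite sine_moment_1. pose proof (INR_S_pos k).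
  pose proof PI_RGT_0. simpl (INR (fact 1)). field. lra.
Qed.

Lemma fourier_term_2 (k : nat) :
  fourier_term 2 k = / PI ^ 2 * ((1 - (-1) ^ S k) / INR (S k) ^ 3).
Proof.
  rewrite fourier_term_rec. unfold fourier_term. rewrite sine_moment_0.
  pose proof (INR_S_pos k). pose proof PI_RGT_0. simpl (INR (fact 0)). field. lra.
Qed.

(** Twice the sum over the odd integers: the even ones contribute [zeta s / 2^s].
    The limit is computed along the partial sums with [2N + 2] terms. *)
Lemma is_series_odd_zeta (s : nat) :
  (2 <= s)%nat ->
  is_series (fun k => (1 - (-1) ^ S k) / INR (S k) ^ s)
    ((2 - 2 / 2 ^ s) * zeta (INR s)).
Proof.
  intro Hs.
  assert (Hex : ex_series (fun k => (1 - (-1) ^ S k) / INR (S k) ^ s)).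
  { apply (ex_series_le (V := R_CompleteNormedModule)) with
      (b := fun k => 2 * / INR (S k) ^ s).
    - intro k. change (norm ?x) with (Rabs x).
      unfold Rdiv. rewrite Rabs_mult, (Rabs_pos_eq (/ _)) by (left; apply inv_pow_pos).
      apply Rmult_le_compat_r; [left; apply inv_pow_pos|].
      pose proof (Rabs_triang 1 (- (-1) ^ S k)) as T.
      rewrite Rabs_Ropp, pow_1_abs, Rabs_R1 in T. unfold Rminus. lra.
    - eexists. exact (is_series_scal (V := R_NormedModule) 2 _ _ (is_series_zeta s Hs)). }
  destruct Hex as [l Hl].
  replace ((2 - 2 / 2 ^ s) * zeta (INR s)) with l; [exact Hl|].
  assert (E : forall N, sum_n (fun k => (1 - (-1) ^ S k) / INR (S k) ^ s) (2 * N + 1)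
     = 2 * sum_n (fun k => / INR (S k) ^ s) (2 * N + 1)
       - 2 / 2 ^ s * sum_n (fun k => / INR (S k) ^ s) N).
  { assert (P : forall n, (-1) ^ (2 * n + 1) = -1).
    { intro n. rewrite pow_add, pow_1_even. ring. }
    assert (I : forall n, INR (S (2 * n + 1)) = 2 * INR (S n)).
    { intro n. replace (S (2 * n + 1)) with (2 * S n)%nat by lia.
      rewrite mult_INR. reflexivity. }
    induction N.
    - change (2 * 0 + 1)%nat with 1%nat. rewrite !sum_n_succ, !sum_n_zero.
      change (INR 2) with (INR (S (2 * 0 + 1))).
      rewrite I, Rpow_mult_distr. unfold Rdiv. rewrite Rinv_mult. real_ring.
    - replace (2 * S N + 1)%nat with (S (S (2 * N + 1))) by lia.
      rewrite !sum_n_succ, IHN.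
      replace (INR (S (S (S (2 * N + 1))))) with (2 * INR (S (S N)))
        by (rewrite <- I; f_equal; lia).
      rewrite <- !tech_pow_Rmult, P, Rpow_mult_distr. unfold Rdiv.
      rewrite Rinv_mult. real_ring. }
  assert (HE : forall u (x : R), is_lim_seq u x -> is_lim_seq (fun N => u (2 * N + 1)%nat) x).
  { intros u x Hu. apply (is_lim_seq_subseq u x (fun N => (2 * N + 1)%nat)); [|exact Hu].
    apply eventually_subseq. intro n. lia. }
  pose proof (HE _ _ Hl) as L1.
  pose proof (is_series_zeta s Hs) as Hz. apply is_series_lim in Hz.
  assert (L2 : is_lim_seq (fun N => sum_n (fun k => (1 - (-1) ^ S k) / INR (S k) ^ s) (2 * N + 1))
     (2 * zeta (INR s) - 2 / 2 ^ s * zeta (INR s))).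
  { eapply is_lim_seq_ext; [intro N; symmetry; apply E|].
    apply is_lim_seq_minus'.
    - apply (is_lim_seq_scal_l _ 2 (zeta (INR s))).
      apply (HE (sum_n (fun k => / INR (S k) ^ s))), Hz.
    - apply (is_lim_seq_scal_l _ (2 / 2 ^ s) (zeta (INR s))), Hz. }
  pose proof (eq_trans (eq_sym (is_lim_seq_unique _ _ L1))
                       (is_lim_seq_unique _ _ L2)) as EL.
  injection EL as ->. real_ring.
Qed.

Lemma is_series_sum_n_m (a : nat -> nat -> R) (l : nat -> R) (p : nat) :
  (forall j, (1 <= j)%nat -> is_series (a j) (l j)) ->
  is_series (fun k => sum_n_m (fun j => a j k) 1 p) (sum_n_m l 1 p).
Proof.
  intro H. destruct p as [|p].
  - rewrite sum_n_m_zero by lia. apply is_series_ext with (fun _ => 0).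
    + intro k. rewrite sum_n_m_zero by lia. reflexivity.
    + apply is_series_lim. apply is_lim_seq_ext with (fun _ => 0).
      * intro N. symmetry. rewrite sum_n_const. apply Rmult_0_r.
      * apply is_lim_seq_const.
  - rewrite <- sum_n_m_S.
    apply is_series_ext with (fun k => sum_n (fun j => a (S j) k) p).
    + intro k. unfold sum_n. rewrite (sum_n_m_S (fun j => a j k)). reflexivity.
    + apply (is_series_sum_n (fun j => a (S j)) (fun j => l (S j))).
      intro k. apply H. lia.
Qed.

Lemma odd_zeta_sum_series (m p : nat) :
  is_series
    (fun k => sum_n_m (fun j => zeta_coef m j * / INR (S k) ^ (2 * j + 1)) 1 p)
    (sum_n_m (fun k => (-1) ^ k * zeta (INR (2 * k + 1))
                / (INR (fact (m - 2 * k)) * PI ^ (2 * k))) 1 p).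
Proof.
  apply (is_series_sum_n_m (fun j k => zeta_coef m j * / INR (S k) ^ (2 * j + 1))).
  intros j Hj.
  replace ((-1) ^ j * zeta (INR (2 * j + 1)) / (INR (fact (m - 2 * j)) * PI ^ (2 * j)))
    with (zeta_coef m j * zeta (INR (2 * j + 1))) by (unfold zeta_coef, Rdiv; ring).
  apply (is_series_scal (V := R_NormedModule)), is_series_zeta. lia.
Qed.

Lemma kronecker_eq (a b : R) : a = b -> kronecker a b = 1.
Proof. intro H. unfold kronecker. destruct (Req_EM_T a b); easy. Qed.

Lemma kronecker_neq (a b : R) : a <> b -> kronecker a b = 0.
Proof. intro H. unfold kronecker. destruct (Req_EM_T a b); easy. Qed.

Lemma fourier_term_sum (m : nat) :
  (1 <= m)%nat ->
  is_series (fourier_term m)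
    (kronecker (INR (m / 2)) (INR m / 2)
       * ((-1) ^ ((3 * m + 2) / 2) * (2 ^ (m + 1) - 1) * zeta (INR (m + 1))
          / (2 * PI) ^ m)
     - sum_n_m
         (fun k : nat =>
            (-1) ^ k * zeta (INR (2 * k + 1))
            / (INR (fact (m - 2 * k)) * PI ^ (2 * k)))
         1 ((m - 1) / 2)).
Proof.
  intro Hm. pose proof PI_RGT_0 as HPI.
  destruct (Nat.Even_or_Odd m) as [[q Hq]|[p Hp]].
  - destruct q as [|p]; [lia|]. assert (Em : m = (2 * p + 2)%nat) by lia. clear Hq.
    rewrite kronecker_eq, Rmult_1_l.
    2: { replace (m / 2)%nat with (S p) by (subst m; apply Nat.div_unique with 0%nat; lia).
         subst m. rewrite plus_INR, mult_INR, S_INR. simpl. field. }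
    replace ((m - 1) / 2)%nat with p by (subst m; apply Nat.div_unique with 1%nat; lia).
    replace ((3 * m + 2) / 2)%nat with (2 * (p + 2) + p)%nat
      by (subst m; apply Nat.div_unique with 0%nat; lia).
    apply is_series_ext with (fun k =>
      (-1) ^ p / PI ^ m * ((1 - (-1) ^ S k) / INR (S k) ^ (m + 1))
      - sum_n_m (fun j => zeta_coef m j * / INR (S k) ^ (2 * j + 1)) 1 p).
    + intro k. real_eq. rewrite Em, fourier_term_closed, fourier_term_2. f_equal.
      pose proof (INR_S_pos k). rewrite !pow_add.
      assert (PI ^ (2 * p) <> 0) by (apply pow_nonzero; lra).
      assert (INR (S k) ^ (2 * p) <> 0) by (apply pow_nonzero; lra).
      field. repeat split; try assumption; lra.
    + apply (is_series_minus (V := R_NormedModule)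
        (fun k => (-1) ^ p / PI ^ m * ((1 - (-1) ^ S k) / INR (S k) ^ (m + 1)))).
      2: apply odd_zeta_sum_series.
      replace ((-1) ^ (2 * (p + 2) + p) * (2 ^ (m + 1) - 1) * zeta (INR (m + 1)) / (2 * PI) ^ m)
       with ((-1) ^ p / PI ^ m * ((2 - 2 / 2 ^ (m + 1)) * zeta (INR (m + 1)))).
      * apply (is_series_scal (V := R_NormedModule)), is_series_odd_zeta. lia.
      * rewrite (pow_add (-1)), pow_1_even, Rpow_mult_distr, (pow_add 2).
        assert (PI ^ m <> 0) by (apply pow_nonzero; lra).
        assert (2 ^ m <> 0) by (apply pow_nonzero; lra).
        field. split; assumption.
  - rewrite kronecker_neq, Rmult_0_l.
    2: { replace (m / 2)%nat with p by (subst m; apply Nat.div_unique with 1%nat; lia).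
         subst m. rewrite plus_INR, mult_INR. simpl. lra. }
    replace ((m - 1) / 2)%nat with p by (subst m; apply Nat.div_unique with 0%nat; lia).
    match goal with |- is_series _ (0 - ?x) =>
      replace (0 - x) with ((-1) * x) by ring end.
    apply is_series_ext with (fun k =>
      (-1) * sum_n_m (fun j => zeta_coef m j * / INR (S k) ^ (2 * j + 1)) 1 p).
    + intro k. real_eq. rewrite Hp, fourier_term_closed, fourier_term_1. ring.
    + apply (is_series_scal (V := R_NormedModule)), odd_zeta_sum_series.
Qed.

(* The series over n >= 1 is reindexed by n = S j; [/] on nat is floor
   division, and [sum_n_m f a b] is 0 when b < a.  When m is even the exponent
   (3 * m + 2) / 2 is exact; when m is odd its term is multiplied by 0. *)
Theorem mainTheorem6 (m : nat) (hm : (1 <= m)%nat) :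
  is_series
    (fun j : nat =>
       let n := S j in
       zeta (INR (2 * n)) / (INR n * rising_prod n m * 4 ^ n))
    (kronecker (INR (m / 2)) (INR m / 2)
       * ((-1) ^ ((3 * m + 2) / 2) * (2 ^ (m + 1) - 1) * zeta (INR (m + 1))
          / (2 * PI) ^ m)
     - sum_n_m
         (fun k : nat =>
            (-1) ^ k * zeta (INR (2 * k + 1))
            / (INR (fact (m - 2 * k)) * PI ^ (2 * k)))
         1 ((m - 1) / 2)
     + (ln PI - harmonic m) / INR (fact m)).
Proof.
  pose proof (fourier_term_sum m hm) as HE.
  destruct m as [|p]; [lia|].
  rewrite <- (is_series_unique _ _ HE), (is_series_unique _ _ (fourier_term_series p)).
  unfold Rminus at 1. rewrite Rplus_assoc, Rplus_opp_l, Rplus_0_r.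
  apply moment_series.
Qed.
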